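(* Let $\mathcal{O}_n$ be either the formal power series ring $K[[X_1,\ldots,X_n]]$ over a field $K$ of characteristic zero, or the ring $\mathbb{C}\{x_1,\ldots,x_n\}$ of convergent power series (with $K=\mathbb{C}$). Let $\mathcal{D}_n=\mathcal{O}_n[\partial_1,\ldots,\partial_n]$ be the ring of $K$-linear differential operators on $\mathcal{O}_n$, and let $M$ be a holonomic $\mathcal{D}_n$-module. Then $H^i(\partial_1,\ldots,\partial_n;M)=0$ for $i<n-\dim M$.
   Context: $\dim M$ is the dimension of the support of $M$ as an $\mathcal{O}_n$-module ($\dim 0=-\infty$). $H^i(\partial_1,\ldots,\partial_n;M)$ is the $i$-th cohomology of the De Rham complex of $M$, i.e. the Koszul cochain complex of $M$ with respect to the commuting $K$-linear maps $\partial_1,\ldots,\partial_n$. *)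

(* Defs.v *)
From mathcomp Require Import all_boot all_order all_algebra.
From mathcomp Require Import reals complex.
Set Implicit Arguments. Unset Strict Implicit. Unset Printing Implicit Defensive.
Import Order.TTheory GRing.Theory Num.Theory.
Local Open Scope ring_scope.

Definition mon (n : nat) := {ffun 'I_n -> nat}.
Definition mdeg n (a : mon n) : nat := (\sum_i a i)%N.
Definition madd n (a b : mon n) : mon n := [ffun i => (a i + b i)%N].
Definition msub n (a b : mon n) : mon n := [ffun i => (a i - b i)%N].
Definition munit n (i : 'I_n) : mon n := [ffun k => nat_of_bool (k == i)].

Definition below n (a : mon n) : seq (mon n) :=
  map (fun b : {ffun 'I_n -> 'I_(mdeg a).+1} => [ffun i => nat_of_ord (b i)] : mon n)
      (filter (fun b : {ffun 'I_n -> 'I_(mdeg a).+1} => [forall i, (b i <= a i)%N])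
              (enum {ffun 'I_n -> 'I_(mdeg a).+1})).

Definition mons_deg n (d : nat) : seq (mon n) :=
  map (fun b : {ffun 'I_n -> 'I_d.+1} => [ffun i => nat_of_ord (b i)] : mon n)
      (filter (fun b : {ffun 'I_n -> 'I_d.+1} => (\sum_i nat_of_ord (b i) == d)%N)
              (enum {ffun 'I_n -> 'I_d.+1})).

Definition conv n (T : Type) (z : T) (add mul : T -> T -> T)
    (f g : mon n -> T) (a : mon n) : T :=
  foldr add z [seq mul (f b) (g (msub a b)) | b <- below a].

Definition PS (K : fieldType) (n : nat) := mon n -> K.
Definition ps0 K n : PS K n := fun _ => 0.
Definition ps1 K n : PS K n := fun a => (mdeg a == 0%N)%:R.
Arguments ps0 : clear implicits.
Arguments ps1 : clear implicits.
Definition psadd K n (f g : PS K n) : PS K n := fun a => f a + g a.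
Definition psmul K n (f g : PS K n) : PS K n := conv 0 +%R *%R f g.
Definition psder K n (i : 'I_n) (f : PS K n) : PS K n :=
  fun a => (a i).+1%:R * f (madd a (munit i)).

Definition convergent (R : realType) n (f : PS R[i] n) : Prop :=
  exists r C : R, 0 < r /\ forall a, `|f a| * Complex (r ^+ mdeg a) 0 <= Complex C 0.

(* ---------- polynomials O[xi_1..xi_n] (coefficients power series) ------- *)
Definition PSX K n := mon n -> PS K n.
Definition px0 K n : PSX K n := fun _ => ps0 K n.
Definition px1 K n : PSX K n := fun b => if mdeg b == 0%N then ps1 K n else ps0 K n.
Arguments px0 : clear implicits.
Arguments px1 : clear implicits.
Definition pxadd K n (s t : PSX K n) : PSX K n := fun b => psadd (s b) (t b).
Definition pxmul K n (s t : PSX K n) : PSX K n := conv (ps0 K n) (@psadd K n) (@psmul K n) s t.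
Definition inOX K n (O : PS K n -> Prop) (s : PSX K n) : Prop :=
  (forall b, O (s b)) /\ exists d, forall b, (d < mdeg b)%N -> forall a, s b a = 0.

Definition prime_ideal (T : Type) (Rg : T -> Prop) (z o : T) (add mul : T -> T -> T)
    (P : T -> Prop) : Prop :=
  (forall x, P x -> Rg x) /\ P z /\
  (forall x y, P x -> P y -> P (add x y)) /\
  (forall x y, Rg x -> P y -> P (mul x y)) /\
  ~ P o /\
  (forall x y, Rg x -> Rg y -> P (mul x y) -> P x \/ P y).

Definition chain_len (T : Type) (Good : (T -> Prop) -> Prop) (p : nat -> T -> Prop)
    (k : nat) : Prop :=
  (forall j, (j <= k)%N -> Good (p j)) /\
  (forall j, (j < k)%N ->
     (forall x, p j x -> p j.+1 x) /\ exists x, p j.+1 x /\ ~ p j x).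

Section Dmod.
Variables (K : fieldType) (n : nat) (O : PS K n -> Prop) (M : zmodType).
Variables (act : PS K n -> M -> M) (der : 'I_n -> M -> M).

Definition is_Dmodule : Prop :=
  (forall f m1 m2, O f -> act f (m1 + m2) = act f m1 + act f m2) /\
  (forall f g m, O f -> O g -> act (psadd f g) m = act f m + act g m) /\
  (forall f g m, O f -> O g -> act (psmul f g) m = act f (act g m)) /\
  (forall m, act (ps1 K n) m = m) /\
  (forall i m1 m2, der i (m1 + m2) = der i m1 + der i m2) /\
  (forall i f m, O f -> der i (act f m) = act (psder i f) m + act f (der i m)) /\
  (forall i j m, der i (der j m) = der j (der i m)).

Inductive ospan (gens : seq M) : M -> Prop :=
  | ospan_gen m : m \in gens -> ospan gens m
  | ospan_0 : ospan gens 0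
  | ospan_add x y : ospan gens x -> ospan gens y -> ospan gens (x + y)
  | ospan_act f x : O f -> ospan gens x -> ospan gens (act f x).

Definition dpow (b : mon n) (m : M) : M :=
  foldr (fun i x => iter (b i) (der i) x) m (enum 'I_n).

(* good filtration w.r.t. the order filtration of D_n; F k = F_k, F_{-1}=0 *)
Definition good_filtration (F : nat -> M -> Prop) : Prop :=
  (forall k, F k 0 /\ (forall x y, F k x -> F k y -> F k (x + y)) /\
             (forall f x, O f -> F k x -> F k (act f x))) /\
  (forall k x, F k x -> F k.+1 x) /\
  (forall k i x, F k x -> F k.+1 (der i x)) /\
  (forall k, exists gens, forall x, F k x <-> ospan gens x) /\
  (forall x, exists k, F k x) /\
  (exists k0, forall k, (k0 <= k)%N -> forall x, F k.+1 x ->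
     exists y (z : 'I_n -> M),
       F k y /\ (forall i, F k (z i)) /\ x = y + \sum_i der i (z i)).

Definition Fz (F : nat -> M -> Prop) (k : nat) : M -> Prop :=
  if k is k'.+1 then F k' else (fun x => x = 0).

(* the degree-d part of s annihilates gr^F M *)
Definition symb_ann (F : nat -> M -> Prop) (d : nat) (s : PSX K n) : Prop :=
  forall j m, F j m -> Fz F (j + d) (\sum_(b <- mons_deg n d) act (s b) (dpow b m)).

(* annihilator of gr^F M in gr D_n = O[xi] (a homogeneous ideal) *)
Definition ann_gr (F : nat -> M -> Prop) (s : PSX K n) : Prop :=
  inOX O s /\ forall d, symb_ann F d s.

(* characteristic variety Ch(M) = V(ann gr^F M); holonomic : dim Ch(M) <= n *)
Definition holonomic : Prop :=
  exists F, good_filtration F /\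
    forall p k,
      chain_len (fun P => prime_ideal (inOX O) (px0 K n) (px1 K n)
                             (@pxadd K n) (@pxmul K n) P
                          /\ forall s, ann_gr F s -> P s) p k ->
      (k <= n)%N.

Definition in_supp (P : PS K n -> Prop) : Prop :=
  prime_ideal O (ps0 K n) (ps1 K n) (@psadd K n) (@psmul K n) P /\
  exists m, forall f, O f -> act f m = 0 -> P f.

(* i < n - dim M  (dim M = sup of lengths of prime chains in Supp M,
   dim 0 = -oo) *)
Definition lt_n_sub_dim (i : nat) : Prop :=
  forall p k, chain_len in_supp p k -> (i + k < n)%N.

(* De Rham complex: cochains are functions on subsets I of {1..n},
   omega = sum_I omega(I) dx_I ;  d(m dx_I) = sum_j d_j m dx_j /\ dx_I *)
Definition dR (w : {set 'I_n} -> M) (J : {set 'I_n}) : M :=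
  \sum_(j in J) (if odd #|[set k in J | (k < j)%N]|
                 then - der j (w (J :\ j)) else der j (w (J :\ j))).

Definition dR_vanish (i : nat) : Prop :=
  forall w : {set 'I_n} -> M,
    (forall I : {set 'I_n}, #|I| != i -> w I = 0) ->
    (forall J, dR w J = 0) ->
    exists v : {set 'I_n} -> M,
      (forall I : {set 'I_n}, #|I|.+1 != i -> v I = 0) /\ (forall J, dR v J = w J).

End Dmod.

Definition DR_vanishing_thm (K : fieldType) (n : nat) (O : PS K n -> Prop) : Prop :=
  forall (M : zmodType) (act : PS K n -> M -> M) (der : 'I_n -> M -> M),
    is_Dmodule O act der -> holonomic O act der ->
    forall i, lt_n_sub_dim O act i -> dR_vanish der i.

(* Main.v *)
(* Let I be the annihilator of the finitely many O-generators of a large step F_k of a good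
   filtration: every element of M is killed by a power of each f in I, and nothing else is
   used of holonomicity.  After linear changes of coordinates, Weierstrass division makes
   O / I finite over the ring O_d of series in the first d variables, with I meeting O_d in 0.
   Going up along the primes (x_0, ..., x_{l-1}) of O_d then gives a chain of d + 1 primes
   over I, so d <= dim M.  For j >= d, integrality of x_j yields an x_j-regular F in I which
   depends only on x_j and the first d variables; from F^s m = 0, repeated differentiation
   shows that der_j is injective modulo the images of the other der_k, k >= d.  So these
   n - d derivations form a regular sequence on M.  Each of them acts as zero on De Rham
   cohomology by Cartan's formula, and the vanishing in degrees below n - d follows by
   induction on the length of the sequence. *)

(* Both rings are treated at once: [admissible] lists the closure properties of a subring of the
   formal series, and the deepest of them is the solvability of one fixed-point equation, which
   yields inverses as well as Weierstrass division. Series in fewer variables are singled out by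
   predicates inside one ring in n variables.

   Coordinates are changed by shears, which act on the module structure and leave the ring alone.
   The new derivations are combinations of the old ones with constant coefficients, hence
   directional derivatives in the original De Rham complex: Cartan's formula applies to them there,
   and the complex itself is never transformed.

   The obstacle is that a derivation is not O-linear: its image is preserved only by series free of
   its variable. Once some derivations have been divided out, the argument for the next one may
   multiply only by series free of the variables already used, which is why F has to be confined to
   x_j and the first d variables.

   Characteristic zero enters twice: to choose a shear parameter off the roots of a polynomial, and
   to keep e! nonzero after e differentiations. *)
From HB Require Import structures.
Require Import Defs.
From mathcomp Require Import all_boot all_order all_algebra.
From mathcomp Require Import reals complex boolp.
From mathcomp Require classical_sets.
From mathcomp Require Import zify ring lra.
Set Implicit Arguments. Unset Strict Implicit. Unset Printing Implicit Defensive.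
Import Order.TTheory GRing.Theory Num.Theory.
Local Open Scope ring_scope.

(* [lia] does not recognise [a i] as a natural number for a finite function [a]. *)
Ltac mlia := repeat match goal with
  | H : context [@fun_of_fin _ _ _ _ _] |- _ => revert H
  end; repeat match goal with
  | |- context [@fun_of_fin ?T ?U ?P ?a ?i] =>
    let x := fresh "x" in
    pose (x := @fun_of_fin T U P a i : nat);
    repeat match goal with
      |- context [@fun_of_fin ?T' ?U' ?P' a i] => change (@fun_of_fin T' U' P' a i) with x
    end; clearbody x
  end; intros; try match goal with |- @eq _ ?a ?b => change (@eq nat a b) end; lia.

(** * Monomials and sums over their divisors *)

Section Monomials.
Variable n : nat.
Implicit Types a b c : mon n.

Lemma monP a b : (forall i : 'I_n, a i = b i) -> a = b.
Proof. by move=> h; apply/ffunP. Qed.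

Definition mle a b := [forall i, (a i <= b i)%N].
Definition mon0 : mon n := [ffun=> 0%N].
Definition mpow (i : 'I_n) (k : nat) : mon n := [ffun j => if j == i then k else 0%N].

Lemma mleP a b : reflect (forall i, (a i <= b i)%N) (mle a b).
Proof. exact: forallP. Qed.

Lemma maddE a b i : madd a b i = (a i + b i)%N. Proof. by rewrite ffunE. Qed.
Lemma msubE a b i : msub a b i = (a i - b i)%N. Proof. by rewrite ffunE. Qed.
Lemma munitE i j : @munit n i j = (j == i). Proof. by rewrite ffunE. Qed.
Lemma mon0E i : mon0 i = 0%N. Proof. by rewrite ffunE. Qed.
Lemma mpowE i k j : mpow i k j = if j == i then k else 0%N.
Proof. by rewrite ffunE. Qed.

Definition monE := (maddE, msubE, munitE, mon0E, mpowE).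

Lemma le_mdeg a i : (a i <= mdeg a)%N.
Proof. by rewrite /mdeg (bigD1 i) //= leq_addr. Qed.

Lemma mdegD a b : mdeg (madd a b) = (mdeg a + mdeg b)%N.
Proof. by rewrite /mdeg -big_split; apply: eq_bigr => i _; rewrite maddE. Qed.

Lemma mdeg_eq0 a : (mdeg a == 0%N) = (a == mon0).
Proof.
apply/eqP/eqP => [h|->]; last by rewrite /mdeg big1 // => i _; rewrite mon0E.
by apply: monP => i; have := le_mdeg a i; rewrite h mon0E leqn0 => /eqP.
Qed.

Lemma mdeg_pow i k : mdeg (mpow i k) = k.
Proof.
rewrite /mdeg (bigD1 i) //= big1 => [|j /negPf ji]; rewrite monE ?ji ?eqxx //.
by rewrite addn0.
Qed.

Lemma mdeg_unit i : mdeg (@munit n i) = 1%N.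
Proof. by rewrite -[RHS](mdeg_pow i); congr mdeg; apply: monP => j; rewrite !monE; case: eqP. Qed.

Lemma mem_below a b : (b \in below a) = mle b a.
Proof.
apply/mapP/mleP => [[x]|h].
  rewrite mem_filter => /andP[/forallP xa _] -> i; rewrite ffunE; exact: xa.
exists [ffun i => inord (b i)]; last first.
  apply: monP => i; rewrite !ffunE inordK // ltnS.
  exact: leq_trans (h i) (le_mdeg a i).
rewrite mem_filter mem_enum andbT; apply/forallP => i; rewrite ffunE inordK //.
by rewrite ltnS; apply: leq_trans (h i) (le_mdeg a i).
Qed.

Lemma below_uniq a : uniq (below a).
Proof.
rewrite map_inj_uniq => [|x y /ffunP h]; first by apply/filter_uniq/enum_uniq.
by apply/ffunP => i; apply: val_inj; have := h i; rewrite !ffunE.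
Qed.

Lemma mle_trans b a c : mle a b -> mle b c -> mle a c.
Proof. by move=> /mleP h /mleP k; apply/mleP => i; apply: leq_trans (k i). Qed.

Lemma mle_refl a : mle a a. Proof. exact/mleP. Qed.

Lemma msub_le a b : mle (msub a b) a.
Proof. by apply/mleP => i; rewrite monE; mlia. Qed.

Lemma msubKr a b : mle b a -> msub a (msub a b) = b.
Proof. by move=> /mleP h; apply: monP => i; have := h i; rewrite !monE; mlia. Qed.

Lemma msubK a b : mle b a -> madd b (msub a b) = a.
Proof. by move=> /mleP h; apply: monP => i; have := h i; rewrite !monE; mlia. Qed.

Lemma maddK a b : msub (madd a b) a = b.
Proof. by apply: monP => i; rewrite !monE; mlia. Qed.

Lemma maddC a b : madd a b = madd b a.
Proof. by apply: monP => i; rewrite !monE; mlia. Qed.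

Lemma mle_addr a b : mle a (madd a b).
Proof. by apply/mleP => i; rewrite !monE; mlia. Qed.

Lemma madd0 a : madd a mon0 = a.
Proof. by apply: monP => i; rewrite !monE; mlia. Qed.

Lemma msub0 a : msub a mon0 = a.
Proof. by apply: monP => i; rewrite !monE; mlia. Qed.

Lemma mle0 a : mle mon0 a.
Proof. by apply/mleP => i; rewrite !monE. Qed.

Section Big.
Variable (V : nmodType).
Implicit Types F : mon n -> V.

Lemma big_below_sub F a b : mle b a ->
  \sum_(c <- below b) F c = \sum_(c <- below a | mle c b) F c.
Proof.
move=> ba; rewrite -[RHS]big_filter; apply: perm_big.
apply: uniq_perm; rewrite ?filter_uniq ?below_uniq // => c.
rewrite mem_filter !mem_below; case: (boolP (mle c b)) => //= cb.
by rewrite (mle_trans cb ba).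
Qed.

Lemma big_below_rev F a :
  \sum_(b <- below a) F b = \sum_(b <- below a) F (msub a b).
Proof.
rewrite -[RHS](big_map (msub a) xpredT); apply: perm_big.
apply: uniq_perm; rewrite ?below_uniq //.
  rewrite map_inj_in_uniq ?below_uniq // => x y; rewrite !mem_below => xa ya e.
  by rewrite -(msubKr xa) e msubKr.
move=> c; apply/idP/mapP => [|[d]]; rewrite mem_below => h.
  by exists (msub a c); rewrite ?mem_below ?msub_le ?msubKr.
by move=> ->; rewrite mem_below msub_le.
Qed.

Lemma big_below_shift F a c : mle c a ->
  \sum_(b <- below a | mle c b) F b = \sum_(d <- below (msub a c)) F (madd c d).
Proof.
move=> ca; rewrite -[RHS](big_map (madd c) xpredT) -[LHS]big_filter; apply: perm_big.
apply: uniq_perm; rewrite ?filter_uniq ?below_uniq //.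
  by rewrite map_inj_uniq ?below_uniq // => x y e; rewrite -(maddK c x) e maddK.
move=> b; rewrite mem_filter mem_below; apply/andP/mapP => [[cb ba]|[d]].
  exists (msub b c); rewrite ?msubK // mem_below.
  by apply/mleP => i; rewrite !monE; have /mleP/(_ i) := ba; mlia.
rewrite mem_below => /mleP da ->; rewrite mle_addr; split=> //.
apply/mleP => i; have := da i; have /mleP/(_ i) := ca; rewrite !monE; mlia.
Qed.

Lemma big_below_only F a b : mle b a -> (forall c, mle c a -> c != b -> F c = 0) ->
  \sum_(c <- below a) F c = F b.
Proof.
move=> ba h; rewrite (bigD1_seq b) ?mem_below ?below_uniq //= big_seq_cond big1 ?addr0 //.
by move=> c /andP[]; rewrite mem_below; apply: h.
Qed.

End Big.
End Monomials.

(** * The ring of formal power series *)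

(** A name of its own, so that the ring structure with the Cauchy product is attached to series and
    not to bare functions. *)
Definition fps (K : fieldType) (n : nat) : Type := PS K n.

Section Ring.
Variables (K : fieldType) (n : nat).
Implicit Types (f g h : fps K n) (a b : mon n).

Lemma psmulE (f g : PS K n) a : psmul f g a = \sum_(b <- below a) f b * g (msub a b).
Proof. by rewrite /psmul /conv foldrE big_map. Qed.

HB.instance Definition _ := gen_eqMixin (fps K n).
HB.instance Definition _ := gen_choiceMixin (fps K n).

Definition psopp f : fps K n := fun a => - f a.

Fact psaddA : associative (@psadd K n : fps K n -> _ -> _).
Proof. by move=> f g h; apply/funext => a; rewrite /psadd addrA. Qed.
Fact psaddC : commutative (@psadd K n : fps K n -> _ -> _).
Proof. by move=> f g; apply/funext => a; rewrite /psadd addrC. Qed.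
Fact psadd0 : left_id (ps0 K n : fps K n) (@psadd K n).
Proof. by move=> f; apply/funext => a; rewrite /psadd add0r. Qed.
Fact psaddN : left_inverse (ps0 K n : fps K n) psopp (@psadd K n).
Proof. by move=> f; apply/funext => a; rewrite /psadd addNr. Qed.

HB.instance Definition _ :=
  GRing.isZmodule.Build (fps K n) psaddA psaddC psadd0 psaddN.

Fact psmulC : commutative (@psmul K n : fps K n -> _ -> _).
Proof.
move=> f g; apply/funext => a; rewrite !psmulE big_below_rev.
by rewrite !big_seq; apply: eq_bigr => b; rewrite mem_below => ba; rewrite msubKr // mulrC.
Qed.

Fact psmulA : associative (@psmul K n : fps K n -> _ -> _).
Proof.
move=> f g h; apply/funext => a; rewrite !psmulE.
under [RHS]eq_big_seq => b.
  rewrite mem_below => ba.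
  rewrite psmulE (big_below_sub _ ba) mulr_suml.
  under eq_bigr => c _ do rewrite -mulrA.
  over.
rewrite (exchange_big_dep xpredT) //=; apply: eq_big_seq => c; rewrite mem_below => ca.
rewrite psmulE mulr_sumr big_below_shift //.
apply: eq_big_seq => d; rewrite mem_below => da; rewrite maddK.
by congr (_ * (_ * h _)); apply: monP => i; rewrite !monE; mlia.
Qed.

Fact psmul1 : left_id (ps1 K n : fps K n) (@psmul K n).
Proof.
move=> f; apply/funext => a; rewrite psmulE (big_below_only (b := mon0 n)) ?mle0 //.
  by rewrite /ps1 mdeg_eq0 eqxx mul1r msub0.
by move=> c _ c0; rewrite /ps1 mdeg_eq0 (negPf c0) mul0r.
Qed.

Fact psmulDl : left_distributive (@psmul K n : fps K n -> _ -> _) (@psadd K n).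
Proof.
move=> f g h; apply/funext => a; rewrite /psadd !psmulE -big_split /=.
by apply: eq_bigr => b _; rewrite mulrDl.
Qed.

Fact ps1_neq0 : (ps1 K n : fps K n) != ps0 K n.
Proof.
apply/eqP => /(congr1 (fun f => f (mon0 n))); rewrite /ps1 mdeg_eq0 eqxx => /eqP.
by rewrite oner_eq0.
Qed.

HB.instance Definition _ :=
  GRing.Zmodule_isComNzRing.Build (fps K n) psmulA psmulC psmul1 psmulDl ps1_neq0.

Lemma fps_addE f g a : (f + g) a = f a + g a. Proof. by []. Qed.
Lemma fps_oppE f a : (- f) a = - f a. Proof. by []. Qed.
Lemma fps_0E a : (0 : fps K n) a = 0. Proof. by []. Qed.
Lemma fps_1E a : (1 : fps K n) a = (a == mon0 n)%:R.
Proof. by rewrite -mdeg_eq0. Qed.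
Lemma fps_mulE f g a : (f * g) a = \sum_(b <- below a) f b * g (msub a b).
Proof. exact: psmulE. Qed.
Lemma fps_sumE (I : Type) (s : seq I) (P : pred I) (F : I -> fps K n) a :
  (\sum_(i <- s | P i) F i) a = \sum_(i <- s | P i) F i a.
Proof. by elim/big_ind2: _ => // f x g y; rewrite fps_addE => -> ->. Qed.

Definition fpsC (k : K) : fps K n := fun a => if a == mon0 n then k else 0.
Definition fpsX (b : mon n) : fps K n := fun a => (a == b)%:R.

Lemma fps_CM k f a : (fpsC k * f) a = k * f a.
Proof.
rewrite fps_mulE (big_below_only (b := mon0 n)) ?mle0 ?msub0 /fpsC ?eqxx //.
by move=> c _ /negPf ->; rewrite mul0r.
Qed.

Lemma fps_XM b f a : (fpsX b * f) a = if mle b a then f (msub a b) else 0.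
Proof.
rewrite fps_mulE; case: ifP => ba.
  rewrite (big_below_only ba) /fpsX ?eqxx ?mul1r //.
  by move=> c _ /negPf ->; rewrite mul0r.
rewrite big_seq big1 // => c; rewrite mem_below /fpsX; case: eqP => [->|]; last by rewrite mul0r.
by rewrite ba.
Qed.

Lemma fpsC1 : fpsC 1 = 1.
Proof. by apply/funext => a; rewrite fps_1E /fpsC; case: eqP. Qed.
Lemma fpsC0 : fpsC 0 = 0.
Proof. by apply/funext => a; rewrite /fpsC; case: eqP. Qed.
Lemma fpsCM k l : fpsC (k * l) = fpsC k * fpsC l.
Proof. by apply/funext => a; rewrite fps_CM /fpsC; case: eqP; rewrite ?mulr0. Qed.
Lemma fpsCD k l : fpsC (k + l) = fpsC k + fpsC l.
Proof. by apply/funext => a; rewrite fps_addE /fpsC; case: eqP; rewrite ?addr0. Qed.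
Lemma fpsCN k : fpsC (- k) = - fpsC k.
Proof. by apply/funext => a; rewrite fps_oppE /fpsC; case: eqP; rewrite ?oppr0. Qed.

Lemma fpsXD b c : fpsX (madd b c) = fpsX b * fpsX c.
Proof.
apply/funext => a; rewrite fps_XM /fpsX; case: ifP => [ba|/negP nb].
  congr (_ %:R); congr nat_of_bool; apply/eqP/eqP => [->|<-]; rewrite ?maddK ?msubK //.
by case: eqP => // e; case: nb; rewrite e mle_addr.
Qed.

Lemma fpsX0 : fpsX (mon0 n) = 1.
Proof. by apply/funext => a; rewrite fps_1E. Qed.

Definition mlex a b := a = b \/ exists i : 'I_n,
  (forall k : 'I_n, (k < i)%N -> a k = b k) /\ (a i < b i)%N.

(** Built one coordinate at a time: among the exponents of f that agree with the current choice on
    the first m coordinates, one with the least next coordinate is taken. *)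
Lemma ex_lexmin f : f <> 0 -> exists a, f a != 0 /\ forall b, f b != 0 -> mlex a b.
Proof.
move=> f0.
suff H (m : nat) : (m <= n)%N -> exists a, f a != 0 /\ forall b, f b != 0 ->
    (forall k : 'I_n, (k < m)%N -> a k = b k) \/ exists i : 'I_n,
    (forall k : 'I_n, (k < i)%N -> a k = b k) /\ (a i < b i)%N.
  have [a [fa ha]] := H n (leqnn n); exists a; split=> // b /ha[e|]; last by right.
  by left; apply: monP => k; apply: e.
elim: m => [_|m IH mn].
  have [a fa] : exists a, f a != 0.
    apply: contrapT => h; apply: f0; apply/funext => a; apply: contrapT => fa.
    by apply: h; exists a; apply/eqP.
  by exists a; split=> // b _; left.
have [a [fa ha]] := IH (ltnW mn); pose i := Ordinal mn.
pose P v := `[< exists b, [/\ f b != 0, forall k : 'I_n, (k < m)%N -> a k = b k & b i = v] >].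
have exP : exists v, P v by exists (a i); apply/asboolP; exists a.
case: (ex_minnP exP) => v /asboolP[b [fb ab bv]] vmin.
exists b; split=> // c fc; case: (ha c fc) => [ac|[j [hj aj]]]; last first.
  have [jm|mj] := ltnP j m.
    right; exists j; split; last by rewrite -ab.
    by move=> k kj; rewrite -ab ?hj //; apply: ltn_trans jm.
  have ac : forall k : 'I_n, (k < m)%N -> a k = c k by move=> k km; apply: hj; apply: leq_trans mj.
  have : P (c i) by apply/asboolP; exists c.
  move/vmin; rewrite leq_eqVlt => /orP[/eqP e|lt].
    left=> k; rewrite ltnS leq_eqVlt => /orP[/eqP km|km]; last by rewrite -ab ?ac.
    by have -> : k = i by [apply: val_inj]; rewrite bv.
  by right; exists i; split; [move=> k km; rewrite -ab ?ac | rewrite bv].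
have : P (c i) by apply/asboolP; exists c.
move/vmin; rewrite leq_eqVlt => /orP[/eqP e|lt].
  left=> k; rewrite ltnS leq_eqVlt => /orP[/eqP km|km]; last by rewrite -ab ?ac.
  by have -> : k = i by [apply: val_inj]; rewrite bv.
by right; exists i; split; [move=> k km; rewrite -ab ?ac | rewrite bv].
Qed.

(* The lexicographically least exponents of f and g add up to one of f g. *)
Lemma fps_mul_eq0 f g : f * g = 0 -> f = 0 \/ g = 0.
Proof.
move=> fg; apply: contrapT => /not_orP[f0 g0].
have [a [fa ha]] := ex_lexmin f0; have [b [gb hb]] := ex_lexmin g0.
have := congr1 (fun h : fps K n => h (madd a b)) fg.
rewrite fps_mulE (big_below_only (mle_addr a b)) ?maddK => [/eqP|c ca /eqP nca].
  by rewrite fps_0E mulf_eq0 (negPf fa) (negPf gb).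
have [->|/ha] := eqVneq (f c) 0; first by rewrite mul0r.
have [->|/hb] := eqVneq (g (msub (madd a b) c)) 0; first by rewrite mulr0.
move=> hd [/esym//|[i [ac aci]]]; exfalso.
have eqk k : (a k + b k = c k + msub (madd a b) c k)%N.
  by rewrite -!maddE msubK.
case: hd => [e|[j [bc bcj]]].
  by have := eqk i; rewrite -e; mlia.
(* At the smaller of the two first differences, the exponents of c and of its complement add up to
   more than a + b allows. *)
have [ij|ji] := leqP i j.
  have := eqk i; have: (b i <= msub (madd a b) c i)%N.
    by move: ij; rewrite leq_eqVlt => /orP[/eqP/val_inj->|/bc->//]; apply: ltnW.
  by mlia.
by have := eqk j; rewrite (ac _ ji); mlia.
Qed.

Lemma fps_exp_eq0 f k : f ^+ k = 0 -> f = 0.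
Proof.
elim: k => [/eqP|k IH]; first by rewrite expr0 oner_eq0.
by rewrite exprS => /fps_mul_eq0[].
Qed.

Definition fder (i : 'I_n) f : fps K n := psder i f.

Lemma fderE i f a : fder i f a = (a i).+1%:R * f (madd a (munit i)). Proof. by []. Qed.

Lemma munit_le (i : 'I_n) b : mle (munit i) b = (0 < b i)%N.
Proof.
apply/mleP/idP => [/(_ i)|h j]; rewrite munitE ?eqxx //.
by case: eqP => // ->.
Qed.

Lemma fderM i f g : fder i (f * g) = fder i f * g + f * fder i g.
Proof.
have half (u v : fps K n) a :
    \sum_(b <- below (madd a (munit i))) (b i)%:R * u b * v (msub (madd a (munit i)) b)
    = (fder i u * v) a.
  rewrite (bigID (mle (munit i))) /= [X in _ + X]big1 ?addr0 => [|b]; last first.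
    by rewrite munit_le -leqNgt leqn0 => /eqP ->; rewrite !mul0r.
  rewrite big_below_shift; last by rewrite maddC mle_addr.
  rewrite [in below _]maddC maddK fps_mulE; apply: eq_bigr => b _.
  rewrite fderE maddC !maddE munitE eqxx addn1; congr (_ * v _).
  by apply: monP => j; rewrite !monE; mlia.
apply/funext => a; rewrite fps_addE [f * fder i g]mulrC -!half [X in _ = _ + X]big_below_rev.
rewrite fderE fps_mulE mulr_sumr -big_split; apply: eq_big_seq => b; rewrite mem_below => ba /=.
have -> : (a i).+1 = (b i + msub (madd a (munit i)) b i)%N.
  by rewrite -maddE msubK // maddE munitE eqxx addn1.
by rewrite (msubKr ba) natrD mulrDl !mulrA [X in _ = _ + X]mulrAC.
Qed.

Lemma fderX i f k : fder i (f ^+ k.+1) = f ^+ k * (k.+1%:R * fder i f).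
Proof.
elim: k => [|k IH]; first by rewrite expr0 !mul1r expr1.
rewrite exprS fderM IH exprS [k.+2%:R]mulrS; ring.
Qed.

Lemma psadd_fps f g : psadd f g = f + g. Proof. by []. Qed.
Lemma psmul_fps f g : psmul f g = f * g. Proof. by []. Qed.
Lemma ps0_fps : ps0 K n = 0 :> fps K n. Proof. by []. Qed.
Lemma ps1_fps : ps1 K n = 1 :> fps K n. Proof. by []. Qed.
Lemma psder_fps i f : psder i f = fder i f. Proof. by []. Qed.

(** Series in fewer variables stay inside [fps K n] as a predicate, so that no embeddings between
    rings of different n occur. *)
Definition indep (Z : pred 'I_n) f := forall a i, Z i -> (0 < a i)%N -> f a = 0.

Lemma indep0 Z : indep Z 0. Proof. by []. Qed.
Lemma indepD Z f g : indep Z f -> indep Z g -> indep Z (f + g).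
Proof. by move=> hf hg a i Zi ai; rewrite fps_addE (hf a i) ?(hg a i) ?addr0. Qed.
Lemma indepN Z f : indep Z f -> indep Z (- f).
Proof. by move=> hf a i Zi ai; rewrite fps_oppE (hf a i) ?oppr0. Qed.
Lemma indepM Z f g : indep Z f -> indep Z g -> indep Z (f * g).
Proof.
move=> hf hg a i Zi ai; rewrite fps_mulE big_seq big1 // => b; rewrite mem_below => /mleP/(_ i) ba.
have [b0|b0] := posnP (b i); last by rewrite (hf b i) ?mul0r.
by rewrite (hg _ i) ?mulr0 // msubE b0 subn0.
Qed.
Lemma indepC Z k : indep Z (fpsC k).
Proof. by move=> a i _ ai; rewrite /fpsC; case: eqP => // e; move: ai; rewrite e mon0E. Qed.
Lemma indep1 Z : indep Z 1. Proof. by rewrite -fpsC1; apply: indepC. Qed.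
Lemma indepXn Z f k : indep Z f -> indep Z (f ^+ k).
Proof.
by move=> hf; elim: k => [|k IH]; [apply: indep1 | rewrite exprS; apply: indepM].
Qed.
Lemma indep_der Z f i : indep Z f -> indep Z (fder i f).
Proof. by move=> hf a j Zj aj; rewrite fderE (hf _ j) ?mulr0 // maddE ltn_addr. Qed.
Lemma indep_sub (Z Y : pred 'I_n) f : (forall i, Y i -> Z i) -> indep Z f -> indep Y f.
Proof. by move=> YZ hf a i Yi; apply: hf; apply: YZ. Qed.
Lemma indep_der0 (Z : pred 'I_n) f i : Z i -> indep Z f -> fder i f = 0.
Proof.
by move=> Zi hf; apply/funext => a; rewrite fderE (hf _ i) ?mulr0 // maddE munitE eqxx addn1.
Qed.
Lemma indep_X (Z : pred 'I_n) b : (forall i, Z i -> b i = 0%N) -> indep Z (fpsX b).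
Proof.
move=> h a i Zi ai; rewrite /fpsX; case: eqP => // e.
by move: ai; rewrite e h.
Qed.

(** Arbitrary selections of coefficients cover both truncation in one variable and substitution of
    0. [fshift b] is the quotient by the monomial b of the part of f divisible by b. *)
Definition fsel (p : pred (mon n)) f : fps K n := fun a => if p a then f a else 0.
Definition fshift (b : mon n) f : fps K n := fun a => f (madd a b).

Lemma indep_sel Z p f : indep Z f -> indep Z (fsel p f).
Proof. by move=> hf a i Zi ai; rewrite /fsel (hf a i) ?if_same. Qed.
Lemma indep_shift Z b f : indep Z f -> indep Z (fshift b f).
Proof. by move=> hf a i Zi ai; rewrite /fshift (hf _ i) // maddE ltn_addr. Qed.

(* Substitution of 0 for the variables in Z. *)
Definition fzero (Z : pred 'I_n) := fsel (fun a => [forall i, Z i ==> (a i == 0%N)]).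

Lemma fzeroD Z f g : fzero Z (f + g) = fzero Z f + fzero Z g.
Proof. by apply/funext => a; rewrite fps_addE /fzero /fsel; case: ifP; rewrite ?addr0. Qed.
Lemma fzero0 Z : fzero Z 0 = 0.
Proof. by apply/funext => a; rewrite /fzero /fsel if_same. Qed.
Lemma fzeroM Z f g : fzero Z (f * g) = fzero Z f * fzero Z g.
Proof.
apply/funext => a; rewrite fps_mulE /fzero /fsel; case: forallP => [h|/existsNP[i /negP]].
  rewrite fps_mulE; apply: eq_big_seq => b; rewrite mem_below => /mleP ba.
  have z c : mle c a -> [forall i, Z i ==> (c i == 0%N)].
    move=> /mleP ca; apply/forallP => i; apply/implyP => Zi.
    by have := ca i; have /implyP/(_ Zi)/eqP -> := h i; rewrite leqn0.
  by rewrite !z //; [apply: msub_le | apply/mleP].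
rewrite negb_imply => /andP[Zi ai].
rewrite big_seq big1 // => b; rewrite mem_below => /mleP ba.
have [bi|bi] := eqVneq (b i) 0%N; last first.
  case: forallP => [/(_ i)/implyP/(_ Zi)|]; first by rewrite (negPf bi).
  by rewrite mul0r.
case: [forall _, _ ==> (msub a b _ == 0%N)] / forallP => [/(_ i)/implyP/(_ Zi)|].
  by rewrite msubE bi subn0 (negPf ai).
by rewrite mulr0.
Qed.
Lemma fzero1 Z : fzero Z 1 = 1.
Proof.
apply/funext => a; rewrite /fzero /fsel fps_1E; case: eqP => [->|_]; last by rewrite if_same.
by case: forallP => // -[] i; rewrite mon0E eqxx implybT.
Qed.
Lemma fzeroXn Z f k : fzero Z (f ^+ k) = fzero Z f ^+ k.
Proof. by elim: k => [|k IH]; rewrite ?expr0 ?fzero1 // !exprS fzeroM IH. Qed.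
Lemma fzero_sub (Z Y : pred 'I_n) f : (forall i, Y i -> Z i) -> fzero Y f = 0 -> fzero Z f = 0.
Proof.
move=> YZ /(congr1 (fun h : fps K n => h _)) h; apply/funext => a; have := h a.
rewrite /fzero /fsel; case: forallP => ha; case: forallP => hb //; case: ha => i.
by apply/implyP => /YZ Zi; have /implyP/(_ Zi) := hb i.
Qed.

Lemma iter_fderE i k f a :
  iter k (fder i) f a = (\prod_(j < k) (a i + j.+1)%:R) * f (madd a (mpow i k)).
Proof.
elim: k a => [|k IH] a.
  by rewrite big_ord0 mul1r; congr f; apply: monP => j; rewrite !monE if_same addn0.
rewrite iterS fderE IH big_ord_recl mulrA; congr (_ * _ * f _).
- by rewrite /= addn1.
- by apply: eq_bigr => j _; rewrite !monE eqxx addn1 addSnnS.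
- by apply: monP => j; rewrite !monE; case: eqP => _; mlia.
Qed.

End Ring.

(** * Linear substitutions *)

Lemma triangle_sum (V : nmodType) (N : nat) (G : nat -> nat -> V) :
  \sum_(k < N) \sum_(j < N - k) G k j = \sum_(m < N) \sum_(k < m.+1) G k (m - k)%N.
Proof.
elim: N => [|N IH]; first by rewrite !big_ord0.
rewrite [RHS]big_ord_recr /= -IH big_ord_recr [in RHS]big_ord_recr /= subnn addrA.
rewrite subSn // subnn big_ord1 -big_split; congr (_ + _); apply: eq_bigr => k _.
by rewrite subSn 1?ltnW // big_ord_recr.
Qed.

Section Shear.
Variables (K : fieldType) (n : nat).
Implicit Types (f g h : fps K n) (a b : mon n) (e : 'I_n).

Lemma mle_pow e (l : nat) b : mle (mpow e l) b = (l <= b e)%N.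
Proof.
apply/mleP/idP => [/(_ e)|h x]; rewrite monE ?eqxx //.
by case: eqP => // ->.
Qed.

(** The divided power of the i-th derivation: the coefficient of y^k in f(x_i + y), written with a
    binomial to avoid dividing by k!. [fshear] is this Taylor expansion at y = s x_e; only k <= a e
    reach the coefficient of a. *)
Definition fdiv (i : 'I_n) (k : nat) f : fps K n :=
  fun a => 'C(a i + k, k)%:R * f (madd a (mpow i k)).

(** Leibniz rule for divided powers; on coefficients it is the Vandermonde identity. *)
Lemma fdivM i k f g :
  fdiv i k (f * g) = \sum_(j < k.+1) fdiv i j f * fdiv i (k - j) g.
Proof.
apply/funext => a; rewrite /fdiv fps_mulE fps_sumE mulr_sumr.
transitivity (\sum_(b <- below (madd a (mpow i k))) \sum_(j < k.+1)
   ('C(b i, j)%:R * f b) *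
   ('C(msub (madd a (mpow i k)) b i, k - j)%:R * g (msub (madd a (mpow i k)) b))).
  apply: eq_big_seq => b; rewrite mem_below => ba.
  have -> : (a i + k = b i + msub (madd a (mpow i k)) b i)%N.
    by rewrite -maddE msubK // !monE eqxx.
  rewrite -binomial.Vandermonde natr_sum mulr_suml; apply: eq_bigr => j _.
  by rewrite natrM; ring.
rewrite exchange_big; apply: eq_bigr => -[j /= jk] _; rewrite ltnS in jk.
rewrite fps_mulE.
(* The binomials vanish unless x_i^j divides b and x_i^(k - j) divides its cofactor, so both sums
   may be restricted to such multiples and then shifted. *)
have bin0 (p q : nat) : ~~ (q <= p)%N -> 'C(p, q)%:R = 0 :> K.
  by rewrite -ltnNge => pq; rewrite bin_small.
rewrite (bigID (mle (mpow i j))) /= [X in _ + X]big1 ?addr0 => [|b]; last first.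
  by rewrite mle_pow => /bin0 ->; rewrite !mul0r.
rewrite big_below_shift; last by rewrite mle_pow !monE eqxx; mlia.
have -> : msub (madd a (mpow i k)) (mpow i j) = madd a (mpow i (k - j)).
  by apply: monP => x; rewrite !monE; case: eqP => _; mlia.
rewrite big_below_rev.
rewrite (bigID (mle (mpow i (k - j)))) /= [X in _ + X]big1_seq ?addr0 => [|d]; last first.
  rewrite mem_below mle_pow => /andP[/bin0 h /mleP da].
  rewrite [X in 'C(X, k - j)](_ : _ = d i) ?h ?mul0r ?mulr0 //.
  by have := da i; rewrite !monE eqxx; mlia.
rewrite big_below_shift; last by rewrite mle_pow !monE eqxx; mlia.
have -> : msub (madd a (mpow i (k - j))) (mpow i (k - j)) = a.
  by apply: monP => x; rewrite !monE; mlia.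
rewrite [RHS]big_below_rev; apply: eq_big_seq => d; rewrite mem_below => /mleP da.
congr ('C(_, _)%:R * f _ * ('C(_, _)%:R * g _)).
- by have := da i; rewrite !monE !eqxx; mlia.
- by apply: monP => x; have := da x; rewrite !monE; case: eqP => _; mlia.
- by have := da i; rewrite !monE !eqxx; mlia.
- by apply: monP => x; have := da x; rewrite !monE; case: eqP => _; mlia.
Qed.

(* The substitution x_i := x_i + s x_e. *)
Definition fshear (i e : 'I_n) (s : K) f : fps K n :=
  fun a => \sum_(k < (a e).+1) s ^+ k * fdiv i k f (msub a (mpow e k)).

Definition sX e (s : K) : fps K n := fpsC s * fpsX K (munit e).

Lemma sX_exp e s k : sX e s ^+ k = fpsC (s ^+ k) * fpsX K (mpow e k).
Proof.
elim: k => [|k IH].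
  rewrite expr0 expr0 fpsC1 mul1r -[LHS]fpsX0; congr fpsX.
  by apply: monP => j; rewrite !monE if_same.
rewrite exprS IH exprS fpsCM.
have -> : mpow e k.+1 = madd (munit e) (mpow e k).
  by apply: monP => j; rewrite !monE; case: eqP => _; mlia.
by rewrite fpsXD /sX; ring.
Qed.

Lemma sX_expM e s k f a :
  (sX e s ^+ k * f) a = if (k <= a e)%N then s ^+ k * f (msub a (mpow e k)) else 0.
Proof. by rewrite sX_exp -mulrA fps_CM fps_XM mle_pow; case: ifP; rewrite ?mulr0. Qed.

Variables (i e : 'I_n).
Hypothesis ie : i != e.

Definition shear_poly (N : nat) f : {poly fps K n} := \poly_(k < N) fdiv i k f.

Lemma shear_horner s N f a : (a e < N)%N ->
  fshear i e s f a = (shear_poly N f).[sX e s] a.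
Proof.
move=> aN; rewrite horner_poly fps_sumE.
rewrite /fshear (big_ord_widen N (fun k => s ^+ k * fdiv i k f (msub a (mpow e k)))) //.
rewrite big_mkcond; apply: eq_bigr => k _.
by rewrite [fdiv i k f * _]mulrC sX_expM ltnS.
Qed.

Lemma shear_polyM N f g :
  take_poly N (shear_poly N f * shear_poly N g) = shear_poly N (f * g).
Proof.
apply/polyP => k; rewrite coef_take_poly coef_poly; case: ifP => // kN.
rewrite coefM fdivM; apply: eq_bigr => -[j /= jk] _.
by rewrite !coef_poly (leq_ltn_trans _ kN) ?(leq_ltn_trans _ kN) ?leq_subr // -ltnS.
Qed.

(** Below degree N in x_e, a shear is the value at s x_e of the Taylor polynomial truncated at N.
    Truncating a product of two such polynomials drops a multiple of (s x_e)^N, which does not reach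
    a coefficient with a e < N. *)
Lemma fshearM s f g : fshear i e s (f * g) = fshear i e s f * fshear i e s g.
Proof.
apply/funext => a; pose N := (a e).+1.
rewrite (@shear_horner _ N) // -shear_polyM.
have -> : (fshear i e s f * fshear i e s g) a
        = ((shear_poly N f).[sX e s] * (shear_poly N g).[sX e s]) a.
  rewrite !fps_mulE; apply: eq_big_seq => b; rewrite mem_below => /mleP ba.
  rewrite !(@shear_horner _ N) // /N ltnS ?ba //.
  by rewrite msubE leq_subr.
rewrite -hornerM -{2}(poly_take_drop N (_ * _)) hornerD hornerM hornerXn fps_addE.
by rewrite [_ * sX e s ^+ N]mulrC sX_expM ltnn addr0.
Qed.

Lemma fdivD k f g : fdiv i k (f + g) = fdiv i k f + fdiv i k g.
Proof. by apply/funext => a; rewrite fps_addE /fdiv fps_addE mulrDr. Qed.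

Lemma fshearD s f g : fshear i e s (f + g) = fshear i e s f + fshear i e s g.
Proof.
apply/funext => a; rewrite fps_addE /fshear -big_split; apply: eq_bigr => k _ /=.
by rewrite fdivD fps_addE mulrDr.
Qed.

Lemma fshear_const s k : fshear i e s (fpsC k) = fpsC k.
Proof.
apply/funext => a; rewrite /fshear big_ord_recl expr0 mul1r /fdiv bin0 mul1r.
rewrite [X in _ + X]big1 ?addr0 => [|j _].
  by congr fpsC; apply: monP => x; rewrite !monE !if_same subn0 addn0.
rewrite /fpsC; case: eqP => [/(congr1 (fun b : mon n => b i))|]; last by rewrite !mulr0.
by rewrite !monE eqxx (negPf ie) lift0; mlia.
Qed.

Lemma fshear0 f : fshear i e 0 f = f.
Proof.
apply/funext => a; rewrite /fshear big_ord_recl expr0 mul1r /fdiv bin0 mul1r.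
rewrite [X in _ + X]big1 ?addr0 => [|j _]; last by rewrite exprS !mul0r.
by congr f; apply: monP => x; rewrite !monE !if_same subn0 addn0.
Qed.

(** The shears form a one-parameter group, by the binomial theorem for (s + t)^m with m = k + j;
    inverses come from it. *)
Lemma fshear_comp s t f : fshear i e s (fshear i e t f) = fshear i e (s + t) f.
Proof.
apply/funext => a; rewrite /fshear.
pose G (k j : nat) : K := s ^+ k * t ^+ j * ('C(k + j, k)%:R *
  fdiv i (k + j) f (msub a (mpow e (k + j)))).
transitivity (\sum_(k < (a e).+1) \sum_(j < (a e).+1 - k) G k j).
  apply: eq_bigr => -[k /= ka] _; rewrite ltnS in ka.
  rewrite {1}/fdiv !mulr_sumr.
  have -> : ((madd (msub a (mpow e k)) (mpow i k)) e).+1 = ((a e).+1 - k)%N.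
    by rewrite !monE eqxx eq_sym (negPf ie) addn0 subSn.
  apply: eq_bigr => j _; rewrite /G /fdiv.
  rewrite !monE !eqxx (negPf ie) !subn0.
  have -> : madd (msub (madd (msub a (mpow e k)) (mpow i k)) (mpow e j)) (mpow i j)
         = madd (msub a (mpow e (k + j))) (mpow i (k + j)).
    apply: monP => x; rewrite !monE; case: (eqVneq x i) => [->|xi].
      by rewrite (negPf ie); mlia.
    by case: eqP => _; mlia.
  (* Both sides are the multinomial coefficient (a i + k + j)! / ((a i)! k! j!). *)
  have E : ('C(a i + k, k) * 'C(a i + k + j, j) =
            'C(k + j, k) * 'C(a i + (k + j), k + j))%N.
    apply/eqP; rewrite -(eqn_pmul2r (fact_gt0 k)) -(eqn_pmul2r (fact_gt0 j)).
    rewrite -(eqn_pmul2r (fact_gt0 (a i))); apply/eqP.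
    have h1 := @bin_fact (a i + k) k (leq_addl _ _).
    have h2 := @bin_fact (a i + k + j) j (leq_addl _ _).
    have h3 := @bin_fact (k + j) k (leq_addr _ _).
    have h4 := @bin_fact (a i + (k + j)) (k + j) (leq_addl _ _).
    rewrite !addnK in h1 h2 h4; rewrite addKn in h3.
    rewrite -!addnA in h1 h2 h4 |- *.
    rewrite -[RHS]/('C(k + j, k) * 'C(a i + (k + j), k + j) * k`! * j`! * (a i)`!)%N.
    transitivity ((a i + (k + j))`!)%N.
      by rewrite -h2 -h1; nia.
    by rewrite -h4 -h3; nia.
  have := congr1 (fun m : nat => m%:R : K) E; rewrite !natrM => E'.
  transitivity (s ^+ k * t ^+ j * ('C(a i + k, k)%:R * 'C(a i + k + j, j)%:R) *
     f (madd (msub a (mpow e (k + j))) (mpow i (k + j)))); first by ring.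
  by rewrite E'; ring.
rewrite triangle_sum; apply: eq_bigr => -[m /= ma] _.
rewrite addrC exprDn mulr_suml; apply: eq_bigr => -[k /= km] _.
rewrite /G subnKC //; set F := fdiv _ _ _ _.
by rewrite -[_ *+ 'C(m, k)]mulr_natr; ring.
Qed.

Lemma fshearK s f : fshear i e s (fshear i e (- s) f) = f.
Proof. by rewrite fshear_comp subrr fshear0. Qed.

Lemma fshear_der_other s f j : j != e -> fder j (fshear i e s f) = fshear i e s (fder j f).
Proof.
move=> je; apply/funext => a; rewrite fderE /fshear mulr_sumr.
have -> : madd a (munit j) e = a e by rewrite !monE eq_sym (negPf je) addn0.
apply: eq_bigr => k _; rewrite /fdiv fderE.
have -> : madd (msub (madd a (munit j)) (mpow e k)) (mpow i k) =
   madd (madd (msub a (mpow e k)) (mpow i k)) (munit j).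
  apply: monP => x; rewrite !monE; case: (eqVneq x j) => [->|xj].
    by rewrite (negPf je); mlia.
  by mlia.
rewrite !monE (negPf ie) (negPf je) !subn0.
have [->|ji] := eqVneq i j; last by rewrite !addn0; ring.
have E : ((a j).+1 * 'C(a j + 1 + k, k) = 'C(a j + k, k) * (a j + k).+1)%N.
  have h1 := @bin_fact (a j + 1 + k) k (leq_addl _ _).
  have h2 := @bin_fact (a j + k) k (leq_addl _ _).
  rewrite !addnK in h1 h2; rewrite addn1 addSn !factS in h1.
  rewrite addn1 addSn.
  apply/eqP; rewrite -(eqn_pmul2r (fact_gt0 k)) -(eqn_pmul2r (fact_gt0 (a j))); apply/eqP.
  by move: h1 h2; set A := 'C(_, _); set B := 'C(_, _); nia.
have := congr1 (fun m : nat => m%:R : K) E; rewrite !natrM => E'.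
set F := f _; transitivity (s ^+ k * ((a j).+1%:R * 'C(a j + 1 + k, k)%:R) * F); first by ring.
by rewrite E'; ring.
Qed.

(** Chain rule for f(x_i + s x_e). *)
Lemma fshear_der_e s f :
  fder e (fshear i e s f) = fshear i e s (fder e f) + fpsC s * fshear i e s (fder i f).
Proof.
have ei : e == i = false by rewrite eq_sym (negPf ie).
apply/funext => a; rewrite fps_addE fps_CM fderE /fshear mulr_sumr.
have -> : madd a (munit e) e = (a e).+1 by rewrite !monE eqxx addn1.
(* All three sums consist of the same terms [T k], with weights a e + 1, a e + 1 - k and k. *)
pose m (k : nat) := madd (msub (madd a (munit e)) (mpow e k)) (mpow i k).
pose T (k : nat) : K := s ^+ k * 'C(a i + k, k)%:R * f (m k).
transitivity (\sum_(k < (a e).+2) (a e).+1%:R * T k).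
  apply: eq_bigr => k _; rewrite /T /fdiv -!mulrA; congr (_ * (_ * ('C(_, _)%:R * f _))).
  by rewrite !monE (negPf ie) addn0 subn0.
have -> : \sum_(k < (a e).+1) s ^+ k * fdiv i k (fder e f) (msub a (mpow e k))
   = \sum_(k < (a e).+2) ((a e).+1 - k)%N%:R * T k.
  rewrite [RHS]big_ord_recr /= subnn mul0r addr0; apply: eq_bigr => -[k /= ka] _.
  rewrite /T /fdiv fderE !monE eqxx (negPf ie) ei subn0 addn0 subSn //.
  have -> : madd (madd (msub a (mpow e k)) (mpow i k)) (munit e) = m k.
    apply: monP => x; rewrite !monE; case: (eqVneq x e) => [->|xe].
      by rewrite ei; mlia.
    by mlia.
  by ring.
have -> : s * \sum_(k < (a e).+1) s ^+ k * fdiv i k (fder i f) (msub a (mpow e k))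
   = \sum_(k < (a e).+2) k%:R * T k.
  rewrite [RHS]big_ord_recl mul0r add0r mulr_sumr; apply: eq_bigr => -[k /= ka] _.
  rewrite /bump add1n /T /fdiv fderE !monE eqxx (negPf ie) subn0.
  have -> : madd (madd (msub a (mpow e k)) (mpow i k)) (munit i) = m k.+1.
    apply: monP => x; rewrite !monE; case: (eqVneq x e) => [->|xe].
      by rewrite ei; mlia.
    by case: eqP => _; mlia.
  have E : ('C(a i + k, k) * (a i + k).+1 = k.+1 * 'C(a i + k.+1, k.+1))%N.
    by rewrite addnS mulnC mul_bin_diag.
  have := congr1 (fun m : nat => m%:R : K) E; rewrite !natrM => E'.
  transitivity (s ^+ k.+1 * ('C(a i + k, k)%:R * (a i + k).+1%:R) * f (m k.+1)).
    by rewrite exprS; ring.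
  by rewrite E'; ring.
rewrite -big_split; apply: eq_bigr => -[k /= ka] _; rewrite -mulrDl -natrD subnK //.
Qed.

Lemma indep_shear Z s f : ~~ Z i -> ~~ Z e -> indep Z f -> indep Z (fshear i e s f).
Proof.
move=> Zi Ze hf a j Zj aj; rewrite /fshear big1 // => k _; rewrite /fdiv (hf _ j) ?mulr0 //.
have /negPf ji : j != i by apply: contraNneq Zi => <-.
have /negPf je : j != e by apply: contraNneq Ze => <-.
by rewrite !monE ji je subn0 addn0.
Qed.

Lemma fshear_coef0 s f a : a e = 0%N -> fshear i e s f a = f a.
Proof.
move=> ae; rewrite /fshear ae big_ord1 expr0 mul1r /fdiv bin0 mul1r; congr f.
by apply: monP => x; rewrite !monE !if_same subn0 addn0.
Qed.

Lemma fshear1 s : fshear i e s 1 = 1.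
Proof. by rewrite -fpsC1 fshear_const. Qed.
Lemma fshear_0 s : fshear i e s 0 = 0.
Proof. by rewrite -(fpsC0 K n) fshear_const. Qed.
Lemma fshearXn s f k : fshear i e s (f ^+ k) = fshear i e s f ^+ k.
Proof. by elim: k => [|k IH]; rewrite ?expr0 ?fshear1 // !exprS fshearM IH. Qed.

End Shear.

(** * Koszul cohomology of a regular sequence of derivations *)

Section Koszul.
Variables (n : nat) (M : zmodType) (der : 'I_n -> M -> M).
Hypothesis derD : forall i x y, der i (x + y) = der i x + der i y.
Hypothesis derC : forall i j x, der i (der j x) = der j (der i x).
Implicit Types (J : {set 'I_n}) (w v : {set 'I_n} -> M) (A : M -> Prop).

Let sgn (b : bool) (x : M) := if b then - x else x.
Let par (j : 'I_n) J := odd #|[set k in J | (k < j)%N]|.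

Section Additive.
Variable phi : M -> M.
Hypothesis phiD : forall x y, phi (x + y) = phi x + phi y.
Lemma additive0 : phi 0 = 0.
Proof. by apply: (addrI (phi 0)); rewrite -phiD !addr0. Qed.
Lemma additiveN x : phi (- x) = - phi x.
Proof. by apply: (addrI (phi x)); rewrite -phiD !subrr additive0. Qed.
Lemma additiveB x y : phi (x - y) = phi x - phi y.
Proof. by rewrite phiD additiveN. Qed.
Lemma additive_sum (I : Type) (s : seq I) (P : pred I) (F : I -> M) :
  phi (\sum_(i <- s | P i) F i) = \sum_(i <- s | P i) phi (F i).
Proof. by elim/big_rec2: _ => [|i y x _ <-]; rewrite ?additive0 ?phiD. Qed.
Lemma additive_sgn b x : phi (sgn b x) = sgn b (phi x).
Proof. by case: b => //=; rewrite additiveN. Qed.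
End Additive.

Lemma sgn_sgn b c x : sgn b (sgn c x) = sgn (b (+) c) x.
Proof. by case: b; case: c; rewrite //= opprK. Qed.
Lemma sgnN b x : sgn (~~ b) x = - sgn b x.
Proof. by case: b; rewrite //= opprK. Qed.
Lemma sgnD b x y : sgn b (x + y) = sgn b x + sgn b y.
Proof. by case: b => //=; rewrite opprD. Qed.

Lemma dRE w J : dR der w J = \sum_(j in J) sgn (par j J) (der j (w (J :\ j))).
Proof. by []. Qed.

Lemma par_del l j J : j \in J -> par l (J :\ j) = par l J (+) (j < l)%N.
Proof.
move=> jJ; have E : [set k in J :\ j | (k < l)%N] = [set k in J | (k < l)%N] :\ j.
  by apply/setP => k; rewrite !inE andbA.
rewrite /par E (cardsD1 j [set k in J | (k < l)%N]) inE jJ /= oddD oddb.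
by rewrite addbC addbA addbb.
Qed.

Lemma par_add l j J : l \notin J -> par j (l |: J) = par j J (+) (l < j)%N.
Proof.
move=> lJ; rewrite -{2}[J](setU1K lJ) par_del ?setU11 //.
by rewrite -addbA addbb addbF.
Qed.

(** Interior product with the vector field of coefficients c. The coefficients are operators on M;
    in the application they are multiplications by constants. *)
Definition contract (c : 'I_n -> M -> M) w J :=
  \sum_(j | j \notin J) sgn (par j J) (c j (w (j |: J))).

Definition dirder (c : 'I_n -> M -> M) x := \sum_j c j (der j x).

Definition scalar_map (phi : M -> M) :=
  (forall x y, phi (x + y) = phi x + phi y) /\
  (forall j x, phi (der j x) = der j (phi x)).

Lemma dirderD c x y : (forall j, scalar_map (c j)) ->
  dirder c (x + y) = dirder c x + dirder c y.
Proof.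
move=> cs; rewrite /dirder -big_split; apply: eq_bigr => j _.
by rewrite derD (cs j).1.
Qed.

Lemma dirder_der c j x : (forall j, scalar_map (c j)) ->
  dirder c (der j x) = der j (dirder c x).
Proof.
move=> cs; rewrite /dirder (additive_sum (derD j)); apply: eq_bigr => k _.
by rewrite derC (cs k).2.
Qed.

(* Cartan's formula: the directional derivative is null-homotopic. *)
Lemma contract_homotopy c w J : (forall j, scalar_map (c j)) ->
  dR der (contract c w) J + contract c (dR der w) J = dirder c (w J).
Proof.
move=> cs; rewrite dRE /contract.
(* The mixed terms of the two compositions are [G j l] with opposite signs; the diagonal terms give
   the directional derivative, with j in J from one composition and outside J from the other. *)
pose G j l := sgn (par j J (+) par l (J :\ j)) (c l (der j (w (l |: (J :\ j))))).
have -> : \sum_(j in J) sgn (par j J) (der j (\sum_(l | l \notin J :\ j)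
      sgn (par l (J :\ j)) (c l (w (l |: J :\ j)))))
  = \sum_(j in J) c j (der j (w J)) + \sum_(j in J) \sum_(l | l \notin J) G j l.
  rewrite -big_split; apply: eq_bigr => j jJ /=.
  rewrite (additive_sum (derD j)) (bigD1 j) /=; last by rewrite !inE eqxx.
  rewrite sgnD (additive_sgn (derD j)) sgn_sgn par_del // ltnn addbF addbb /=.
  rewrite setD1K // (cs j).2; congr (_ + _).
  rewrite (additive_sum (sgnD _)); apply: eq_big => [l|l _].
    rewrite !inE negb_and negbK andb_orl andbN /=.
    by case: eqVneq => [->|_]; rewrite ?jJ ?andbT.
  by rewrite (additive_sgn (derD j)) sgn_sgn -(cs l).2.
have -> : \sum_(l | l \notin J) sgn (par l J) (c l (dR der w (l |: J)))
  = \sum_(l | l \notin J) c l (der l (w J)) - \sum_(l | l \notin J) \sum_(j in J) G j l.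
  rewrite -sumrB; apply: eq_bigr => l lJ.
  rewrite dRE (bigD1 l) ?setU11 //= (cs l).1 sgnD (additive_sgn (cs l).1) sgn_sgn.
  rewrite par_add // ltnn addbF addbb /= setU1K //; congr (_ + _).
  rewrite (additive_sum (cs l).1) (additive_sum (sgnD _)) -sumrN.
  apply: eq_big => [j|j /andP[jJ jl]].
    by rewrite !inE; case: eqVneq => [->|_]; rewrite ?(negPf lJ) ?andbT.
  rewrite !inE (negPf jl) /= in jJ.
  rewrite (additive_sgn (cs l).1) sgn_sgn /G -sgnN par_del // par_add //.
  have -> : (l |: J) :\ j = l |: J :\ j.
    by apply/setP => k; rewrite !inE; case: (eqVneq k l) => [->|]; rewrite // eq_sym jl.
  congr sgn; move: jl; rewrite neq_ltn; case: ltngtP => //= _ _;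
  by case: (par j J); case: (par l J).
rewrite [X in _ - X]exchange_big /= addrACA subrr addr0.
by rewrite /dirder [RHS](bigID (mem J)).
Qed.

Lemma dRD w v J : dR der (fun I => w I + v I) J = dR der w J + dR der v J.
Proof. by rewrite !dRE -big_split; apply: eq_bigr => j _; rewrite derD sgnD. Qed.

Lemma dR0 w J : (forall I, w I = 0) -> dR der w J = 0.
Proof.
move=> w0; rewrite dRE big1 // => j _.
by rewrite w0 (additive0 (derD j)) /sgn oppr0 if_same.
Qed.

Lemma dR_dR w J : dR der (dR der w) J = 0.
Proof.
pose G j l := sgn (par j J (+) par l (J :\ j)) (der j (der l (w (J :\ j :\ l)))).
have -> : dR der (dR der w) J = \sum_(j in J) \sum_(l in J | l != j) G j l.
  rewrite dRE; apply: eq_bigr => j jJ; rewrite dRE (additive_sum (derD j)).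
  rewrite (additive_sum (sgnD _)); apply: eq_big => [l|l _]; first by rewrite !inE andbC.
  by rewrite (additive_sgn (derD j)) sgn_sgn.
(* Removing j before l or l before j gives opposite signs; splitting at l < j turns the cancellation
   into an exchange of sums. *)
have -> : \sum_(j in J) \sum_(l in J | l != j) G j l =
   \sum_(j in J) \sum_(l in J | (l < j)%N) G j l + \sum_(j in J) \sum_(l in J | (j < l)%N) G j l.
  rewrite -big_split; apply: eq_bigr => j _; rewrite (bigID (fun l : 'I_n => (l < j)%N)) /=.
  by congr (_ + _); apply: eq_bigl => l; rewrite -andbA; congr (_ && _);
    rewrite -val_eqE /=; case: ltngtP.
rewrite (exchange_big_dep (mem J)) /=; last by move=> j l _ /andP[].
rewrite -big_split big1 // => l lJ /=.
apply/eqP; rewrite addrC addr_eq0 -sumrN; apply/eqP.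
apply: eq_big => [j|j /andP[jJ lj]]; first by rewrite lJ.
rewrite /G -sgnN derC.
have -> : J :\ l :\ j = J :\ j :\ l by apply/setP => k; rewrite !inE andbCA.
congr sgn; rewrite !par_del // lj ltnNge (ltnW lj) /=.
by case: (par j J); case: (par l J).
Qed.

Variable C : (M -> M) -> Prop.
Hypothesis C_scalar : forall phi, C phi -> scalar_map phi.
Hypothesis C_comm : forall phi psi, C phi -> C psi -> forall x, phi (psi x) = psi (phi x).

(** Quotients M / A are handled as congruences modulo A. Stability is asked under the derivations
    and the operators of [C] only, since the image of a derivation is in general not an
    O-submodule. *)
Definition stable A := A 0 /\ (forall x y, A x -> A y -> A (x + y)) /\
  (forall x, A x -> A (- x)) /\ (forall j x, A x -> A (der j x)) /\
  (forall phi x, C phi -> A x -> A (phi x)).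

Definition adjoin_image A c x := exists y u, A y /\ x = y + dirder c u.

Lemma stable_adjoin A c : (forall j, C (c j)) -> stable A -> stable (adjoin_image A c).
Proof.
move=> Cc [A0 [AD [AN [Ad Ac]]]]; have cs j := C_scalar (Cc j).
have dD x y : dirder c (x + y) = dirder c x + dirder c y := dirderD x y cs.
split; first by exists 0, 0; rewrite (additive0 dD) addr0.
split=> [x y [p [u [Ap ->]]] [q [v [Aq ->]]]|].
  by exists (p + q), (u + v); split; [apply: AD | rewrite dD addrACA].
split=> [x [p [u [Ap ->]]]|].
  by exists (- p), (- u); split; [apply: AN | rewrite (additiveN dD) opprD].
split=> [j x [p [u [Ap ->]]]|phi x Cphi [p [u [Ap ->]]]].
  by exists (der j p), (der j u); split; [apply: Ad | rewrite derD dirder_der].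
exists (phi p), (phi u); split; first exact: Ac.
have [phiD phid] := C_scalar Cphi.
rewrite phiD /dirder (additive_sum phiD); congr (_ + _); apply: eq_bigr => j _.
by rewrite (C_comm Cphi (Cc j)) phid.
Qed.

Lemma stable_sum A (I : Type) (s : seq I) (P : pred I) (F : I -> M) : stable A ->
  (forall i, P i -> A (F i)) -> A (\sum_(i <- s | P i) F i).
Proof. by move=> [A0 [AD _]] h; elim/big_ind: _. Qed.

Lemma stable_sgn A b x : stable A -> A x -> A (sgn b x).
Proof. by move=> [_ [_ [AN _]]]; case: b => //=; apply: AN. Qed.

Lemma stable_dR A w J : stable A -> (forall I, A (w I)) -> A (dR der w J).
Proof.
move=> sA h; rewrite dRE; apply: (stable_sum _ sA) => j _; apply: (stable_sgn _ sA).
by case: sA => [_ [_ [_ [Ad _]]]]; apply: Ad.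
Qed.

Lemma stable_contract A c w J : (forall j, C (c j)) -> stable A -> (forall I, A (w I)) ->
  A (contract c w J).
Proof.
move=> Cc sA h; apply: (stable_sum _ sA) => j _; apply: (stable_sgn _ sA).
by case: sA => [_ [_ [_ [_ Ac]]]]; apply: Ac.
Qed.

(** The regular sequences of commutative algebra, for directional derivatives acting on M / A. *)
Fixpoint regular_mod A (cs : seq ('I_n -> M -> M)) : Prop :=
  if cs is c :: cs' then
    [/\ forall j, C (c j), forall x, A (dirder c x) -> A x & regular_mod (adjoin_image A c) cs']
  else True.

Lemma koszul_vanishing cs A i w : stable A -> regular_mod A cs -> (i < size cs)%N ->
  (forall I : {set 'I_n}, #|I| != i -> w I = 0) -> (forall J, A (dR der w J)) ->
  exists v : {set 'I_n} -> M, (forall I : {set 'I_n}, #|I|.+1 != i -> v I = 0) /\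
    (forall J, A (w J - dR der v J)).
Proof.
elim: cs A i w => // c cs IH A i w sA [Cc inj reg] ics wi dw.
have sA' := stable_adjoin Cc sA; have [A0 [AD [AN [Ad Ac]]]] := sA.
have cS j := C_scalar (Cc j).
have dD x y : dirder c (x + y) = dirder c x + dirder c y := dirderD x y cS.
have AB x y : A x -> A y -> A (x - y) by move=> Ax Ay; apply: AD => //; apply: AN.
have cartan J : dR der (contract c w) J = dirder c (w J) - contract c (dR der w) J.
  by rewrite -(contract_homotopy w J cS) addrK.
have degc (I : {set 'I_n}) : #|I|.+1 != i -> contract c w I = 0.
  move=> Ii; rewrite /contract big1 // => j jI.
  by rewrite wi ?cardsU1 ?jI // (additive0 (cS j).1) /sgn oppr0 if_same.
case: i ics wi degc => [|i] ics wi degc.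
  (* In degree 0 the contraction of w vanishes, so Cartan's formula leaves D w = contract c (dw),
     which lies in A. *)
  exists (fun=> 0); split=> // J; rewrite (dR0 (w := fun=> 0)) // subr0; apply: inj.
  rewrite -(contract_homotopy w J cS) (dR0 (w := contract c w)) ?add0r; last by move=> I; apply: degc.
  exact: stable_contract.
have [v [vi hv]] : exists v : {set 'I_n} -> M, (forall I : {set 'I_n}, #|I|.+1 != i -> v I = 0) /\
    (forall J, adjoin_image A c (contract c w J - dR der v J)).
  apply: IH => // J; rewrite cartan; exists (- contract c (dR der w) J), (w J).
  by rewrite addrC; split=> //; apply: AN; apply: stable_contract.
(* The preimages are chosen set by set; off degree i the value 0 is taken, so that u is
   homogeneous. *)
have /choice[u hu] J : exists u, (#|J| != i -> u = 0) /\
    A (contract c w J - dR der v J - dirder c u).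
  have [Ji|Ji] := eqVneq #|J| i; last first.
    exists 0; split=> //; rewrite degc // dRE big1 => [|j jJ].
      by rewrite (additive0 dD) !subr0.
    rewrite vi ?(additive0 (derD j)) /sgn ?oppr0 ?if_same //.
    by move: Ji; rewrite (cardsD1 j J) jJ.
  have [y [u [Ay e]]] := hv J; exists u; split=> //.
  by rewrite e addrK.
exists u; split=> [I|J]; first by rewrite eqSS => /(hu I).1.
apply: inj; rewrite (additiveB dD).
have dud : dirder c (dR der u J) = dR der (fun I => dirder c (u I)) J.
  rewrite !dRE (additive_sum dD); apply: eq_bigr => j _.
  by rewrite (additive_sgn dD) dirder_der.
(* Subtracting dv costs nothing because [dR] squares to 0. *)
have E : dR der (contract c w) J - dirder c (dR der u J) =
    dR der (fun I => contract c w I - dR der v I - dirder c (u I)) J.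
  have E1 : dR der (fun I => contract c w I - dR der v I - dirder c (u I) + (dR der v I + dirder c (u I))) J
      = dR der (contract c w) J.
    by rewrite !dRE; apply: eq_bigr => j _; rewrite -[_ - _ - _]addrA -opprD subrK.
  by rewrite -E1 dud !dRD dR_dR add0r addrK.
have -> : dirder c (w J) - dirder c (dR der u J) =
    contract c (dR der w) J + (dR der (contract c w) J - dirder c (dR der u J)).
  by rewrite cartan addrA addrCA subrr addr0.
rewrite E; apply: AD; first exact: stable_contract.
by apply: (stable_dR _ sA) => I; have [_] := hu I.
Qed.

End Koszul.

(** * Weierstrass division *)

Section Admissible.
Variables (K : fieldType) (n : nat).
Implicit Types (f g h u v q : fps K n) (a b c : mon n) (W Z : pred 'I_n) (O : fps K n -> Prop).

(** Membership in the ideal generated by the variables of W. *)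
Definition order1 W h := forall a, (forall i, W i -> a i = 0%N) -> h a = 0.

(** What the formal and the convergent series share. [adm_fix] with b = 1 gives inverses, and with b
    a power of x_j Weierstrass division; its clause on Z ensures that the solution brings in no new
    variables. *)
Record admissible O : Prop := Admissible {
  admC : forall k, O (fpsC k);
  admX : forall b, O (fpsX K b);
  admD : forall f g, O f -> O g -> O (f + g);
  admM : forall f g, O f -> O g -> O (f * g);
  adm_der : forall i f, O f -> O (fder i f);
  adm_shear : forall i e s f, i != e -> O f -> O (fshear i e s f);
  adm_sel : forall p f, O f -> O (fsel p f);
  adm_shift : forall b f, O f -> O (fshift b f);
  adm_fix : forall W b h u, O h -> O u -> order1 W h -> (forall i, W i -> b i = 0%N) ->
    exists q, [/\ O q, q = u + fshift b (h * q) &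
      forall Z, indep Z h -> indep Z u -> indep Z q] }.

Lemma fshiftD b f g : fshift b (f + g) = fshift b f + fshift b g.
Proof. by []. Qed.
Lemma fshift_sum b (I : Type) (s : seq I) (F : I -> fps K n) :
  fshift b (\sum_(i <- s) F i) = \sum_(i <- s) fshift b (F i).
Proof. by apply/funext => a; rewrite /fshift !fps_sumE. Qed.

Section Fix.
Variables (W : pred 'I_n) (b : mon n) (h u : fps K n).
Hypotheses (hW : order1 W h) (bW : forall i, W i -> b i = 0%N).

Definition wdeg a := (\sum_(i | W i) a i)%N.
Definition fix_step v := fshift b (h * v).
(** Neumann series of [fix_step]. Each step raises the degree in the variables of W, since h has
    order one there and b is free of them; hence only k <= [wdeg a] contribute to the coefficient of
    a. *)
Definition fix_sol : fps K n := fun a => (\sum_(k < (wdeg a).+1) iter k fix_step u) a.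

Lemma wdegD a c : wdeg (madd a c) = (wdeg a + wdeg c)%N.
Proof. by rewrite /wdeg -big_split; apply: eq_bigr => i _; rewrite maddE. Qed.

Lemma wdeg_b : wdeg b = 0%N.
Proof. by rewrite /wdeg big1 // => i /bW. Qed.

Lemma fix_step_local v v' k a :
  (forall c, (wdeg c < k)%N -> v c = v' c) -> (wdeg a <= k)%N -> fix_step v a = fix_step v' a.
Proof.
move=> vv ak; rewrite /fix_step /fshift !fps_mulE; apply: eq_big_seq => c; rewrite mem_below => cab.
have [c0|c0] := eqVneq (h c) 0; first by rewrite c0 !mul0r.
rewrite vv //; have := wdegD c (msub (madd a b) c); rewrite msubK // wdegD wdeg_b.
have : (0 < wdeg c)%N.
  rewrite lt0n; apply: contra_neq c0 => cW; apply: hW => i Wi.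
  by move/eqP: cW; rewrite /wdeg (bigD1 i) //= addn_eq0 => /andP[/eqP].
lia.
Qed.

Lemma fix_step0 : fix_step 0 = 0.
Proof. by rewrite /fix_step mulr0. Qed.

Lemma iter_fix_step_low k a : (wdeg a < k)%N -> iter k fix_step u a = 0.
Proof.
elim: k a => // k IH a ak; rewrite iterS.
rewrite (@fix_step_local _ 0 k) ?fix_step0 // => c ck; exact: IH.
Qed.

Lemma fix_sol_trunc N a : (wdeg a < N)%N -> fix_sol a = (\sum_(k < N) iter k fix_step u) a.
Proof.
move=> aN; rewrite /fix_sol !fps_sumE (big_ord_widen N (fun k => iter k fix_step u a)) //.
rewrite big_mkcond; apply: eq_bigr => k _; case: ifP => // /negbT.
by rewrite -leqNgt => ak; rewrite iter_fix_step_low.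
Qed.

Lemma fix_solE : fix_sol = u + fix_step fix_sol.
Proof.
apply/funext => a; rewrite fps_addE.
rewrite (@fix_step_local _ (\sum_(k < wdeg a) iter k fix_step u) (wdeg a)) //; last first.
  exact: fix_sol_trunc.
rewrite /fix_sol big_ord_recl fps_addE; congr (_ + _).
by rewrite /fix_step mulr_sumr fshift_sum.
Qed.

Lemma indep_fix_sol Z : indep Z h -> indep Z u -> indep Z fix_sol.
Proof.
move=> Zh Zu a i Zi ai; rewrite /fix_sol fps_sumE big1 // => -[k /= _] _.
suff H : indep Z (iter k fix_step u) by apply: H ai.
by elim: k => //= k IH; apply/indep_shift/indepM.
Qed.

End Fix.

Section Theory.
Variable O : fps K n -> Prop.
Hypothesis Oadm : admissible O.

Lemma adm0 : O 0. Proof. by rewrite -(fpsC0 K n); apply: admC. Qed.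
Lemma adm1 : O 1. Proof. by rewrite -(fpsC1 K n); apply: admC. Qed.
Lemma admN f : O f -> O (- f).
Proof. by move=> Of; rewrite -mulN1r -(fpsC1 K n) -fpsCN; apply: (admM Oadm) => //; apply: admC. Qed.
Lemma admB f g : O f -> O g -> O (f - g).
Proof. by move=> Of /admN Og; apply: (admD Oadm). Qed.
Lemma admXn f k : O f -> O (f ^+ k).
Proof.
by move=> Of; elim: k => [|k IH]; [apply: adm1 | rewrite exprS; apply: (admM Oadm)].
Qed.
Lemma adm_nat k : O k%:R.
Proof.
elim: k => [|k IH]; first exact: adm0.
by rewrite mulrS; apply: (admD Oadm) => //; apply: adm1.
Qed.
Lemma adm_sum (I : Type) (s : seq I) (P : pred I) (F : I -> fps K n) :
  (forall i, P i -> O (F i)) -> O (\sum_(i <- s | P i) F i).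
Proof. by move=> h; elim/big_ind: _ => //; [apply: adm0 | apply: (admD Oadm)]. Qed.

Lemma fshift0 f : fshift (mon0 n) f = f.
Proof. by apply/funext => a; rewrite /fshift madd0. Qed.

Lemma fshift_XM b f : fshift b (fpsX K b * f) = f.
Proof. by apply/funext => a; rewrite /fshift fps_XM maddC mle_addr maddK. Qed.

(** With h = 1 - f / c of order one in all variables, the solution of q = 1 + h q is c / f. *)
Lemma adm_inv f : O f -> f (mon0 n) != 0 ->
  exists g, [/\ O g, f * g = 1 & forall Z, indep Z f -> indep Z g].
Proof.
move=> Of f0; set c := f (mon0 n) in f0.
pose h := 1 - fpsC c^-1 * f.
have Oh : O h by apply: admB (admM Oadm (admC Oadm _) Of); apply: adm1.
have hW : order1 xpredT h.
  move=> a a0; have -> : a = mon0 n by apply: monP => i; rewrite mon0E a0.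
  by rewrite /h fps_addE fps_oppE fps_CM fps_1E eqxx mulVf // subrr.
have [//|q [Oq eq indq]] := adm_fix Oadm Oh adm1 hW (b := mon0 n).
  by move=> i _; rewrite mon0E.
exists (q * fpsC c^-1); split=> [||Z Zf].
- exact: admM Oadm _ _ Oq (admC Oadm _).
- rewrite fshift0 in eq; have e : q - h * q = 1 by rewrite {1}eq addrK.
  by rewrite -e /h; ring.
- apply: indepM; last exact: indepC.
  apply: indq; last exact: indep1.
  apply: indepD; first exact: indep1.
  by apply/indepN/indepM => //; apply: indepC.
Qed.

(** Write f = P + x_j^e U with U a unit of inverse V and P of degree less than e in x_j. That g - q
    V f has no term of degree at least e in x_j is the fixed-point equation for q with h = - P V and
    b = x_j^e. *)
Lemma weierstrass_division W j e f g : O f -> O g -> ~~ W j ->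
  indep (fun i => ~~ W i && (i != j)) f ->
  (forall k, (k < e)%N -> f (mpow j k) = 0) -> f (mpow j e) != 0 ->
  exists q r, [/\ O q, O r, g = q * f + r, forall a, (e <= a j)%N -> r a = 0 &
    forall Z, indep Z f -> indep Z g -> indep Z r].
Proof.
move=> Of Og Wj fW flow fe.
pose P := fsel (fun a : mon n => (a j < e)%N) f; pose X := fpsX K (mpow j e).
pose U := fshift (mpow j e) f.
have fE : f = P + X * U.
  apply/funext => a; rewrite fps_addE fps_XM /P /fsel mle_pow /U /fshift.
  by case: leqP => ja; rewrite ?add0r ?addr0 // maddC msubK // mle_pow.
have OU : O U by apply: adm_shift.
have U0 : U (mon0 n) != 0 by rewrite /U /fshift maddC madd0.
have [V [OV UV indV]] := adm_inv OU U0.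
have OP : O P by apply: adm_sel.
pose h := - (P * V).
have Oh : O h by apply/admN/(admM Oadm).
(* f involves only x_j and the variables of W, and its pure powers of x_j below e vanish, so every
   monomial of P contains a variable of W. *)
have hW : order1 W h.
  move=> a a0; rewrite /h fps_oppE fps_mulE big_seq big1 ?oppr0 // => c; rewrite mem_below => /mleP ca.
  suff -> : P c = 0 by rewrite mul0r.
  rewrite /P /fsel; case: ifP => // ce.
  have [/existsP[i /andP[ij ci]]|/existsPn hc] := boolP [exists i, (i != j) && (0 < c i)%N].
    apply: (fW c i) => //; rewrite ij andbT; apply: contraTN ci => Wi.
    by rewrite -leqNgt (leq_trans (ca i)) // a0.
  rewrite -(flow _ ce); congr f; apply: monP => i; rewrite monE.
  by have := hc i; case: eqVneq => [->|_] //=; rewrite -leqNgt leqn0 => /eqP.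
have [i Wi|q [Oq eq indq]] := adm_fix Oadm Oh (adm_shift Oadm (mpow j e) Og) hW (b := mpow j e).
  by rewrite monE; case: eqP => // ij; rewrite ij (negPf Wj) in Wi.
have Oq' : O (q * V) by apply: (admM Oadm).
exists (q * V), (g - q * V * f); split=> // [||a ea|Z Zf Zg].
- by apply: admB => //; apply: (admM Oadm).
- by rewrite addrC subrK.
- have rE : g - q * V * f = g + h * q - X * q.
    rewrite {1}fE /h; transitivity (g + - (P * V) * q - X * q * (U * V)); first by ring.
    by rewrite UV mulr1.
  have : fshift (mpow j e) (g - q * V * f) = 0.
    have sB x y : fshift (mpow j e) (x - y) = fshift (mpow j e) x - fshift (mpow j e) y by [].
    by rewrite rE sB fshiftD fshift_XM -eq subrr.
  move=> /(congr1 (fun x : fps K n => x (msub a (mpow j e)))).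
  by rewrite /fshift maddC msubK // mle_pow.
- have ZV : indep Z V by apply/indV/indep_shift.
  apply: indepD => //; apply/indepN/indepM => //; apply: indepM => //; apply: indq.
    by apply/indepN/indepM => //; apply: indep_sel.
  exact: indep_shift.
Qed.

End Theory.
End Admissible.

(** * Convergence *)

Lemma admissible_formal (K : fieldType) (n : nat) : admissible (fun _ : fps K n => True).
Proof.
split=> // W b h u _ _ hW bW; exists (fix_sol W b h u); split=> //; first exact: fix_solE.
by move=> Z; apply: indep_fix_sol.
Qed.

Section Convergent.
Variables (R : realType) (K : fieldType) (n : nat) (nrm : K -> R).
Hypotheses (nrm0 : nrm 0 = 0) (nrm1 : nrm 1 = 1).
Hypotheses (nrm_ge0 : forall x, 0 <= nrm x).
Hypotheses (nrmD : forall x y, nrm (x + y) <= nrm x + nrm y).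
Hypotheses (nrmM : forall x y, nrm (x * y) = nrm x * nrm y).
Implicit Types (f g h u v : fps K n) (a b c m : mon n) (rho : 'I_n -> R).

Lemma nrm_sum (I : Type) (s : seq I) (P : pred I) (F : I -> K) :
  nrm (\sum_(i <- s | P i) F i) <= \sum_(i <- s | P i) nrm (F i).
Proof.
elim/big_rec2: _ => [|i y x _ h]; first by rewrite nrm0.
by rewrite (le_trans (nrmD _ _)) // lerD2l.
Qed.
Lemma nrm_nat k : nrm k%:R <= k%:R.
Proof.
elim: k => [|k IH]; first by rewrite nrm0.
by rewrite -[k.+1]addn1 !natrD (le_trans (nrmD _ _)) // nrm1 lerD2r.
Qed.
Lemma nrmX x k : nrm (x ^+ k) = nrm x ^+ k.
Proof. by elim: k => [|k IH]; rewrite ?expr0 // !exprS nrmM IH. Qed.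

(** Cauchy estimate, stated with a modulus valued in the ordered field R. *)
Definition cvbound (r C : R) f := forall a, nrm (f a) * r ^+ mdeg a <= C.
Definition cvg_series f := exists r C : R, 0 < r /\ cvbound r C f.

Lemma cvbound_ge0 r C f : cvbound r C f -> 0 <= C.
Proof.
move=> /(_ (mon0 n)); have -> : mdeg (mon0 n) = 0%N by apply/eqP; rewrite mdeg_eq0.
by rewrite expr0 mulr1; apply: le_trans.
Qed.

Lemma cvbound_le r C r' C' f : 0 < r' -> r' <= r -> C <= C' ->
  cvbound r C f -> cvbound r' C' f.
Proof.
move=> r0 rr CC h a; apply: le_trans CC; apply: le_trans (h a); rewrite ler_wpM2l //.
by rewrite lerXn2r // nnegrE; lra.
Qed.

Lemma cvg_common f g : cvg_series f -> cvg_series g ->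
  exists r C : R, [/\ 0 < r, cvbound r C f & cvbound r C g].
Proof.
move=> [r [C [r0 fC]]] [s [D [s0 gD]]].
have C0 := cvbound_ge0 fC; have D0 := cvbound_ge0 gD.
exists (Num.min r s), (C + D); split; first by rewrite lt_min r0.
  by apply: cvbound_le fC; rewrite ?lt_min ?r0 // ?ge_min ?lexx //; lra.
by apply: cvbound_le gD; rewrite ?lt_min ?r0 // ?ge_min ?lexx ?orbT //; lra.
Qed.

Definition mweight rho a := \prod_i rho i ^+ a i.
(** Weighted l1 norm on a polydisc, expressed by its finite partial sums. Unlike the sup bound
    [cvbound] it is submultiplicative, which is what products and iterations require. *)
Definition wnorm_le rho f (C : R) := forall m, \sum_(a <- below m) nrm (f a) * mweight rho a <= C.

Section Weights.
Variable rho : 'I_n -> R.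
Hypothesis rho_gt0 : forall i, 0 < rho i.

Lemma mweight_gt0 a : 0 < mweight rho a.
Proof. by apply: prodr_gt0 => i _; apply: exprn_gt0. Qed.

Lemma mweightD a b : mweight rho (madd a b) = mweight rho a * mweight rho b.
Proof. by rewrite /mweight -big_split; apply: eq_bigr => i _; rewrite maddE exprD. Qed.

Lemma wterm_ge0 f a : 0 <= nrm (f a) * mweight rho a.
Proof. by rewrite mulr_ge0 // ltW ?mweight_gt0. Qed.

Lemma wnorm_ge0 f C : wnorm_le rho f C -> 0 <= C.
Proof. by move=> /(_ (mon0 n)); apply: le_trans; apply: sumr_ge0 => a _; apply: wterm_ge0. Qed.

Lemma wnorm_coef f C a : wnorm_le rho f C -> nrm (f a) * mweight rho a <= C.
Proof.
move=> /(_ a); apply: le_trans; rewrite (bigD1_seq a) ?below_uniq ?mem_below ?mle_refl //=.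
by rewrite lerDl sumr_ge0 // => b _; apply: wterm_ge0.
Qed.

Lemma wnormM f g C D : wnorm_le rho f C -> wnorm_le rho g D -> wnorm_le rho (f * g) (C * D).
Proof.
move=> fC gD m; pose F a := nrm (f a) * mweight rho a; pose G a := nrm (g a) * mweight rho a.
have F0 a : 0 <= F a by apply: wterm_ge0.
have G0 a : 0 <= G a by apply: wterm_ge0.
apply: (@le_trans _ _ (\sum_(a <- below m) \sum_(b <- below m | mle b a) F b * G (msub a b))).
  rewrite !big_seq; apply: ler_sum => a; rewrite mem_below => am.
  rewrite -(big_below_sub _ am) fps_mulE.
  apply: (le_trans (ler_wpM2r (ltW (mweight_gt0 a)) (nrm_sum _ _ _))).
  rewrite mulr_suml !big_seq; apply: ler_sum => b; rewrite mem_below => ba.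
  by rewrite nrmM -{2}(msubK ba) mweightD /F /G le_eqVlt; apply/orP; left; apply/eqP; ring.
rewrite (exchange_big_dep xpredT) //=.
apply: (@le_trans _ _ (\sum_(b <- below m) F b * D)).
  rewrite !big_seq; apply: ler_sum => b; rewrite mem_below => bm.
  rewrite (big_below_shift _ bm) -mulr_sumr ler_wpM2l //.
  by under eq_bigr => d _ do rewrite maddK; apply: gD.
by rewrite -mulr_suml ler_wpM2r ?(wnorm_ge0 gD).
Qed.

Lemma wnorm_shift f C b : wnorm_le rho f C -> wnorm_le rho (fshift b f) (C / mweight rho b).
Proof.
move=> fC m; rewrite ler_pdivlMr ?mweight_gt0 // mulr_suml.
apply: le_trans (fC (madd m b)); rewrite [X in _ <= X](bigID (mle b)) /=.
rewrite (@big_below_shift _ _ _ (madd m b) b); last by rewrite maddC mle_addr.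
rewrite (_ : msub (madd m b) b = m); last by rewrite maddC maddK.
rewrite -[X in X <= _]addr0 lerD //; last by apply: sumr_ge0 => a _; apply: wterm_ge0.
by apply: ler_sum => a _; rewrite /fshift -mulrA -mweightD maddC.
Qed.

Lemma wnorm_cvg f C s : 0 < s -> (forall i, s <= rho i) ->
  (forall a, nrm (f a) * mweight rho a <= C) -> cvg_series f.
Proof.
move=> s0 srho fC; exists s, C; split=> // a; apply: le_trans (fC a); rewrite ler_wpM2l //.
have -> : s ^+ mdeg a = \prod_i s ^+ a i by rewrite /mdeg prodrXr.
apply: ler_prod => i _; apply/andP; split; first by rewrite exprn_ge0 // ltW.
by rewrite lerXn2r // nnegrE ltW //; apply: lt_le_trans (srho i).
Qed.

End Weights.

Lemma sum_half N : \sum_(k < N) (2^-1 : R) ^+ k <= 2.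
Proof.
have -> : \sum_(k < N) (2^-1 : R) ^+ k = 2 - 2 * 2^-1 ^+ N.
  elim: N => [|N IH]; first by rewrite big_ord0 expr0; ring.
  by rewrite big_ord_recr /= IH exprS; field.
have : 0 <= (2^-1 : R) ^+ N by rewrite exprn_ge0 // invr_ge0.
lra.
Qed.

(** Enlarging the range to a box gives a product of n geometric sums, each at most 2. *)
Lemma sum_below_half m : \sum_(a <- below m) (2^-1 : R) ^+ mdeg a <= 2 ^+ n.
Proof.
rewrite /below big_map big_filter big_enum_cond /=.
apply: (@le_trans _ _ (\sum_(b : {ffun 'I_n -> 'I_(mdeg m).+1}) \prod_i (2^-1 : R) ^+ b i)).
  rewrite big_mkcond; apply: ler_sum => b _; case: ifP => _.
    by rewrite /mdeg -prodrXr; under eq_bigr do rewrite ffunE.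
  by apply: prodr_ge0 => i _; rewrite exprn_ge0 // invr_ge0.
rewrite -(bigA_distr_bigA (fun (i : 'I_n) (k : 'I_(mdeg m).+1) => (2^-1 : R) ^+ k)).
apply: (@le_trans _ _ (\prod_(i < n) 2)); last by rewrite prodr_const card_ord.
apply: ler_prod => i _; rewrite sum_half andbT.
by apply: sumr_ge0 => k _; rewrite exprn_ge0 // invr_ge0.
Qed.

Definition polyradius (W : pred 'I_n) (t gamma : R) i := t * (if W i then gamma else 1).

Lemma mweight_polyradius W t gamma a :
  mweight (polyradius W t gamma) a = t ^+ mdeg a * gamma ^+ wdeg W a.
Proof.
rewrite /mweight /polyradius /mdeg /wdeg -!prodrXr [X in _ = _ * X]big_mkcond -big_split.
by apply: eq_bigr => i _ /=; rewrite exprMn; case: (W i); rewrite ?expr1n.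
Qed.

(** Halving the radius turns a sup bound into an l1 bound at the cost of 2^n; D records a gain from
    still smaller radii in some variables. *)
Lemma wnorm_half rho r C D f : 0 <= D -> cvbound r C f -> 0 < r ->
  (forall a, f a != 0 -> mweight rho a <= D * (r / 2) ^+ mdeg a) -> wnorm_le rho f (D * (C * 2 ^+ n)).
Proof.
move=> D0 fC r0 hw m; have C0 := cvbound_ge0 fC.
apply: (@le_trans _ _ (\sum_(a <- below m) D * (C * 2^-1 ^+ mdeg a))).
  apply: ler_sum => a _; have [->|fa] := eqVneq (f a) 0.
    by rewrite nrm0 mul0r !mulr_ge0 // exprn_ge0 // invr_ge0.
  apply: (le_trans (ler_wpM2l (nrm_ge0 _) (hw a fa))).
  rewrite exprMn mulrCA ler_wpM2l // mulrA ler_wpM2r ?exprn_ge0 ?invr_ge0 //; exact: fC.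
by rewrite -!mulr_sumr !ler_wpM2l // sum_below_half.
Qed.

Lemma cvgM f g : cvg_series f -> cvg_series g -> cvg_series (f * g).
Proof.
move=> cf cg; have [r [C [r0 fC gC]]] := cvg_common cf cg.
pose rho := polyradius pred0 (r / 2) 1.
have r2 : 0 < r / 2 by rewrite divr_gt0.
have rho0 i : 0 < rho i by rewrite /rho /polyradius /= mulr1.
have hw a : mweight rho a <= 1 * (r / 2) ^+ mdeg a by rewrite mweight_polyradius expr1n mulr1 mul1r.
have fn := wnorm_half ler01 fC r0 (fun a _ => hw a).
have gn := wnorm_half ler01 gC r0 (fun a _ => hw a).
apply: (wnorm_cvg rho0 r2) => [i|a].
  by rewrite /rho /polyradius mulr1.
exact: wnorm_coef (wnormM rho0 fn gn).
Qed.

(** Shrinking only the radii of the variables in W makes h small without changing the weight of b.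
    Each step then halves the weighted norm, and a geometric series dominates the Neumann series. *)
Lemma cvg_fix W b h u : cvg_series h -> cvg_series u -> order1 W h ->
  (forall i, W i -> b i = 0%N) -> cvg_series (fix_sol W b h u).
Proof.
move=> ch cu hW bW; have [r [C [r0 hC uC]]] := cvg_common ch cu.
have C0 := cvbound_ge0 hC; pose t := r / 2; have t0 : 0 < t by rewrite divr_gt0.
(* eps is half the weight of b; gamma is chosen so that gamma <= 1 and gamma * D <= eps. *)
pose eps := t ^+ mdeg b / 2; have eps0 : 0 < eps by rewrite divr_gt0 ?exprn_gt0.
pose D := C * 2 ^+ n; have D0 : 0 <= D by rewrite mulr_ge0 ?exprn_ge0.
pose gamma := eps / (eps + D).
have g0 : 0 < gamma by rewrite divr_gt0 //; lra.
have g1 : gamma <= 1 by rewrite ler_pdivrMr; lra.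
have [t0' g0'] : 0 <= t /\ 0 <= gamma by split; exact: ltW.
have gD : gamma * D <= eps.
  by rewrite /gamma mulrAC ler_pdivrMr ?ler_wpM2l //; lra.
pose rho := polyradius W t gamma.
have rho0 i : 0 < rho i by rewrite mulr_gt0 //; case: ifP.
have hn : wnorm_le rho h eps.
  have h1 : wnorm_le rho h (gamma * D).
    apply: (wnorm_half (ltW g0) hC r0) => a ha; rewrite mweight_polyradius mulrC.
    rewrite ler_wpM2r ?exprn_ge0 //.
    have : (0 < wdeg W a)%N.
      rewrite lt0n; apply: contra_neq ha => aW; apply: hW => i Wi.
      by move/eqP: aW; rewrite /wdeg (bigD1 i) //= addn_eq0 => /andP[/eqP].
    case: (wdeg W a) => // k _; rewrite exprS.
    by apply: ler_piMr => //; apply: exprn_ile1.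
  by move=> m; apply: le_trans gD; apply: h1.
have un : wnorm_le rho u D.
  rewrite -[D]mul1r; apply: (wnorm_half ler01 uC r0) => a _.
  by rewrite mweight_polyradius mul1r ler_piMr ?exprn_ge0 ?exprn_ile1.
have wb : mweight rho b = t ^+ mdeg b.
  by rewrite mweight_polyradius wdeg_b // expr0 mulr1.
have step v E : wnorm_le rho v E -> wnorm_le rho (fix_step b h v) (2^-1 * E).
  move=> vE; have := wnorm_shift rho0 b (wnormM rho0 hn vE).
  rewrite wb (_ : eps * E / t ^+ mdeg b = 2^-1 * E) //.
  by rewrite /eps; field; rewrite expf_neq0 ?gt_eqF.
have it k : wnorm_le rho (iter k (fix_step b h) u) (2^-1 ^+ k * D).
  by elim: k => [|k IH]; rewrite ?mul1r // exprS -mulrA; apply: step.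
apply: (wnorm_cvg rho0 (mulr_gt0 t0 g0) (C := 2 * D)).
  by move=> i; rewrite /rho /polyradius; case: ifP; rewrite // ler_wpM2l.
move=> a; rewrite /fix_sol fps_sumE.
apply: (le_trans (ler_wpM2r (ltW (mweight_gt0 rho0 a)) (nrm_sum _ _ _))).
apply: (@le_trans _ _ (\sum_(k < (wdeg W a).+1) 2^-1 ^+ k * D)).
  by rewrite mulr_suml; apply: ler_sum => k _; apply: (wnorm_coef rho0); apply: it.
by rewrite -mulr_suml ler_wpM2r // sum_half.
Qed.

Lemma cvg_der i f : cvg_series f -> cvg_series (fder i f).
Proof.
move=> [r [C [r0 fC]]]; have C0 := cvbound_ge0 fC.
exists (r / 2), (C / r); split; first by rewrite divr_gt0.
move=> a; rewrite fderE nrmM ler_pdivlMr //.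
apply: le_trans (fC (madd a (munit i))); rewrite mdegD mdeg_unit exprD expr1.
(* Halving the radius absorbs the factor a i + 1, which is at most 2 to the degree of a. *)
have h : nrm (a i).+1%:R * 2^-1 ^+ mdeg a <= 1.
  rewrite exprVn ler_pdivrMr ?exprn_gt0 // mul1r.
  apply: (le_trans (nrm_nat _)); rewrite -natrX ler_nat.
  by apply: (leq_ltn_trans (le_mdeg a i)); apply: ltn_expl.
rewrite exprMn.
have -> : nrm (a i).+1%:R * nrm (f (madd a (munit i))) * (r ^+ mdeg a * 2^-1 ^+ mdeg a) * r
  = nrm (a i).+1%:R * 2^-1 ^+ mdeg a * (nrm (f (madd a (munit i))) * (r ^+ mdeg a * r)) by ring.
by rewrite ler_piMl // mulr_ge0 // mulr_ge0 ?exprn_ge0 // ltW.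
Qed.

Lemma cvg_shift b f : cvg_series f -> cvg_series (fshift b f).
Proof.
move=> [r [C [r0 fC]]]; exists r, (C / r ^+ mdeg b); split=> // a.
rewrite ler_pdivlMr ?exprn_gt0 //; apply: le_trans (fC (madd a b)).
by rewrite mdegD exprD mulrA.
Qed.

Lemma cvg_sel p f : cvg_series f -> cvg_series (fsel p f).
Proof.
move=> [r [C [r0 fC]]]; exists r, C; split=> // a; rewrite /fsel; case: ifP => // _.
by rewrite nrm0 mul0r (cvbound_ge0 fC).
Qed.

(** A shear preserves total degree, and its binomial weights sum to at most (1 + |s|)^(a i + a e),
    which the smaller radius r / (1 + |s|) absorbs. *)
Lemma cvg_shear i e s f : i != e -> cvg_series f -> cvg_series (fshear i e s f).
Proof.
move=> ie [r [C [r0 fC]]]; have C0 := cvbound_ge0 fC.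
pose S := 1 + nrm s; have S1 : 1 <= S by rewrite lerDl.
have S0 : 0 < S by apply: lt_le_trans S1.
exists (r / S), C; split; first by rewrite divr_gt0.
move=> a; rewrite exprMn exprVn mulrA ler_pdivrMr ?exprn_gt0 //.
apply: (le_trans (ler_wpM2r (exprn_ge0 _ (ltW r0)) (nrm_sum _ _ _))); rewrite mulr_suml.
apply: (@le_trans _ _ (\sum_(k < (a i + a e).+1) C * (nrm s ^+ k *+ 'C(a i + a e, k)))); last first.
  rewrite -mulr_sumr ler_wpM2l //.
  have -> : \sum_(k < (a i + a e).+1) nrm s ^+ k *+ 'C(a i + a e, k) = S ^+ (a i + a e).
    by rewrite exprDn; apply: eq_bigr => k _; rewrite expr1n mul1r.
  rewrite ler_weXn2l // /mdeg (bigD1 i) //= leq_add2l (bigD1 e) ?leq_addr //.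
  by rewrite eq_sym.
have le1 : ((a e).+1 <= (a i + a e).+1)%N by rewrite ltnS leq_addl.
rewrite (big_ord_widen _ (fun k => nrm (s ^+ k * fdiv i k f (msub a (mpow e k))) * r ^+ mdeg a) le1).
rewrite big_mkcond; apply: ler_sum => k _; case: ifP => ka; last first.
  by rewrite mulr_ge0 // mulrn_wge0 // exprn_ge0.
rewrite ltnS in ka; rewrite /fdiv !nrmM nrmX -[X in _ <= _ * X]mulr_natr.
set b := madd (msub a _) _.
have -> : mdeg a = mdeg b.
  rewrite /b mdegD mdeg_pow -[in LHS](@msubK _ a (mpow e k)) ?mle_pow //.
  by rewrite mdegD mdeg_pow addnC.
have -> : msub a (mpow e k) i = a i by rewrite !monE (negPf ie) subn0.
have hb : nrm 'C(a i + k, k)%:R <= 'C(a i + a e, k)%:R.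
  by apply: (le_trans (nrm_nat _)); rewrite ler_nat leq_bin2l // leq_add2l.
have -> : nrm s ^+ k * (nrm 'C(a i + k, k)%:R * nrm (f b)) * r ^+ mdeg b
   = (nrm (f b) * r ^+ mdeg b) * (nrm s ^+ k * nrm 'C(a i + k, k)%:R) by ring.
apply: ler_pM; first by rewrite mulr_ge0 ?exprn_ge0 // ltW.
- by rewrite mulr_ge0 ?exprn_ge0.
- exact: fC.
- by rewrite ler_wpM2l ?exprn_ge0.
Qed.

Lemma admissible_convergent : admissible cvg_series.
Proof.
split.
- move=> k; exists 1, (nrm k); split=> // a; rewrite expr1n mulr1 /fpsC; case: ifP => // _.
  by rewrite nrm0.
- move=> b; exists 1, 1; split=> // a; rewrite expr1n mulr1 /fpsX.
  by case: eqP => _; rewrite ?nrm1 ?nrm0.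
- move=> f g cf cg; have [r [C [r0 fC gC]]] := cvg_common cf cg.
  exists r, (C + C); split=> // a; rewrite fps_addE.
  apply: (le_trans (ler_wpM2r _ (nrmD _ _))); first by rewrite exprn_ge0 ?ltW.
  by rewrite mulrDl lerD.
- exact: cvgM.
- exact: cvg_der.
- by move=> i e s f; apply: cvg_shear.
- exact: cvg_sel.
- exact: cvg_shift.
move=> W b h u ch cu hW bW; exists (fix_sol W b h u); split; first exact: cvg_fix.
  exact: fix_solE.
by move=> Z; apply: indep_fix_sol.
Qed.

End Convergent.

Lemma admissible_complex (R : realType) (n : nat) : admissible (@convergent R n : fps R[i] n -> Prop).
Proof.
have -> : (@convergent R n : fps R[i] n -> Prop) = cvg_series (@ComplexField.Normc.normc R).
  have E (z : R[i]) (x C : R) : (`|z| * Complex x 0 <= Complex C 0) =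
      (ComplexField.Normc.normc z * x <= C).
    by rewrite -lecR rmorphM.
  by apply/funext => f; apply/propext; split=> -[r [C [r0 fC]]]; exists r, C; split=> // a;
    have := fC a; rewrite E.
apply: admissible_convergent.
- exact: ComplexField.Normc.normc0.
- exact: ComplexField.Normc.normc1.
- by case=> x y; apply: sqrtr_ge0.
- exact: le_normcD.
- exact: ComplexField.Normc.normcM.
Qed.

(** * Chains of primes over an ideal in normal position *)

(** For subrings given by a predicate; applied to polynomials with coefficients in O_d and to O. *)
Lemma det_closed (A : comNzRingType) (P : A -> Prop) :
  P 0 -> P 1 -> P (-1) -> (forall x y, P x -> P y -> P (x + y)) ->
  (forall x y, P x -> P y -> P (x * y)) ->
  forall (m : nat) (B : 'M[A]_m), (forall i j, P (B i j)) -> P (\det B).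
Proof.
move=> P0 P1 PN PD PM m B PB; rewrite /determinant; apply: (big_ind P) => // s _; apply: (PM).
  by rewrite -signr_odd; case: odd.
by apply: (big_ind P) => [|x y|i _]; [|apply: (PM)|apply: PB].
Qed.

Section Primes.
Variables (K : fieldType) (n : nat) (O : fps K n -> Prop).
Hypothesis Oadm : admissible O.
Implicit Types (f g : fps K n) (I J P S : fps K n -> Prop).

Definition idealO J := (forall f, J f -> O f) /\ J 0 /\
  (forall f g, J f -> J g -> J (f + g)) /\ (forall f g, O f -> J g -> J (f * g)).

Definition primeO P := prime_ideal O (0 : fps K n) 1 +%R *%R P.

Lemma ideal_sum J (T : Type) (s : seq T) (Q : pred T) (F : T -> fps K n) : idealO J ->
  (forall i, Q i -> J (F i)) -> J (\sum_(i <- s | Q i) F i).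
Proof. by move=> [_ [J0 [JD _]]] h; apply: (big_ind J). Qed.

Lemma ideal_adjoin J x : idealO J -> O x ->
  idealO (fun f => exists p g, [/\ J p, O g & f = p + x * g]).
Proof.
move=> [JO [J0 [JD JM]]] Ox; split=> [f [p [g [Jp Og ->]]]|].
  by apply: (admD Oadm); [apply: JO | apply: (admM Oadm)].
split; first by exists 0, 0; split; rewrite ?mulr0 ?addr0 //; apply: adm0.
split=> [f f' [p [g [Jp Og ->]]] [p' [g' [Jp' Og' ->]]]|f f' Of [p [g [Jp Og ->]]]].
  exists (p + p'), (g + g'); split; [exact: JD | exact: (admD Oadm) | ring].
by exists (f * p), (f * g); split; [exact: JM | exact: (admM Oadm) | ring].
Qed.

(** Krull: an ideal maximal among those containing J and missing S is prime. *)
Lemma exists_prime_avoiding J S : idealO J -> (forall f, S f -> O f) -> S 1 ->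
  (forall f g, S f -> S g -> S (f * g)) -> (forall f, J f -> ~ S f) ->
  exists P, [/\ primeO P, forall f, J f -> P f & forall f, P f -> ~ S f].
Proof.
move=> Jid SO S1 SM JS.
pose ok P := [/\ idealO P, forall f, J f -> P f & forall f, P f -> ~ S f].
have okJ : ok J by split.
(* The empty set is let in because the union of an empty chain is empty; maximality rules it out
   afterwards. *)
have [F Fok Ftot|P [[P0|[Pid JP PS]] Pmax]] :=
    @classical_sets.Zorn_bigcup (fps K n) (fun A => (forall f, ~ A f) \/ ok A).
- pose U f := exists2 A, F A & A f; rewrite -/U.
  have [[A0 FA0 okA0]|noA] := pselect (exists2 A, F A & ok A); last first.
    left=> f [A FA Af]; case: (Fok A FA) => [/(_ f)//|okA].
    by apply: noA; exists A.
  have okF A f : F A -> A f -> ok A by move=> FA Af; case: (Fok A FA) => // /(_ f).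
  have [[A0O [A00 [A0D A0M]]] JA0 A0S] := okA0.
  right; split=> [|f Jf|f [A FA Af]]; last first.
  + by have [_ _ AS] := okF A f FA Af; apply: AS.
  + by exists A0 => //; apply: JA0.
  split=> [f [A FA Af]|]; first by have [[AO _] _ _] := okF A f FA Af; apply: AO.
  split; first by exists A0.
  split=> [f g [A FA Af] [B FB Bg]|f g Of [A FA Ag]]; last first.
    by have [[_ [_ [_ AM]]] _ _] := okF A g FA Ag; exists A => //; apply: AM.
  have [[_ [_ [AD _]]] _ _] := okF A f FA Af; have [[_ [_ [BD _]]] _ _] := okF B g FB Bg.
  by case: (Ftot A B FA FB) => AB; [exists B => //; apply: BD => //; apply: AB
    | exists A => //; apply: AD => //; apply: AB].
- exfalso; apply: (Pmax J); last by right.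
  by split=> [f /P0|JP] //; have [_ [/JP/P0]] := Jid.
have [PO [P0 [PD PM]]] := Pid.
(* By maximality, adjoining to P an element outside it reaches S. For x and y outside P with x y in
   P, the product of the two elements so found lies both in P and in S. *)
have maxP x : O x -> ~ P x -> exists f, S f /\ exists p g, [/\ P p, O g & f = p + x * g].
  move=> Ox Px; apply: contrapT => h.
  apply: (Pmax (fun f => exists p g, [/\ P p, O g & f = p + x * g])).
    split=> [f Pf|sub]; first by exists f, 0; split; rewrite ?mulr0 ?addr0 //; apply: (adm0 Oadm).
    by apply/Px/sub; exists 0, 1; split; rewrite ?mulr1 ?add0r //; apply: (adm1 Oadm).
  right; split=> [|f /JP Pf|f Qf Sf]; first exact: ideal_adjoin.
    by exists f, 0; split; rewrite ?mulr0 ?addr0 //; apply: (adm0 Oadm).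
  by apply: h; exists f.
exists P; split=> //; do 5!split=> //; first by move/PS.
move=> x y Ox Oy Pxy; apply: contrapT => /not_orP[Px Py].
have [f [Sf [p [g [Pp Og fE]]]]] := maxP x Ox Px.
have [f' [Sf' [p' [g' [Pp' Og' fE']]]]] := maxP y Oy Py.
apply: (PS (f * f')) (SM _ _ Sf Sf').
have -> : f * f' = f' * p + (x * g * p' + g * g' * (x * y)) by rewrite fE fE'; ring.
apply: (PD); first by apply: (PM) => //; apply: SO.
by apply: (PD); apply: (PM) => //; apply: (admM Oadm).
Qed.

Section Normalized.
Variables (I : fps K n -> Prop) (d : nat).
Hypothesis Iid : idealO I.

Definition low f := O f /\ indep (fun i : 'I_n => (d <= i)%N) f.

Lemma low0 : low 0. Proof. by split; [apply: (adm0 Oadm) | apply: indep0]. Qed.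
Lemma low1 : low 1. Proof. by split; [apply: (adm1 Oadm) | apply: indep1]. Qed.
Lemma lowD f g : low f -> low g -> low (f + g).
Proof. by move=> [Of hf] [Og hg]; split; [apply: (admD Oadm) | apply: indepD]. Qed.
Lemma lowM f g : low f -> low g -> low (f * g).
Proof. by move=> [Of hf] [Og hg]; split; [apply: (admM Oadm) | apply: indepM]. Qed.
Lemma lowN f : low f -> low (- f).
Proof. by move=> [Of hf]; split; [apply: (admN Oadm) | apply: indepN]. Qed.
Lemma lowXn f k : low f -> low (f ^+ k).
Proof. by move=> lf; elim: k => [|k IH]; [apply: low1 | rewrite exprS; apply: lowM]. Qed.
Lemma low_sum (T : Type) (s : seq T) (Q : pred T) (F : T -> fps K n) :
  (forall i, Q i -> low (F i)) -> low (\sum_(i <- s | Q i) F i).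
Proof. by move=> h; apply: (big_ind low) => //; [apply: low0 | apply: lowD]. Qed.

(* f is an O_d-combination of L modulo I. *)
Fixpoint spanned (L : seq (fps K n)) f : Prop :=
  if L is x :: L' then exists c, low c /\ spanned L' (f - c * x) else I f.

Lemma spanned_cat L1 L2 f1 f2 : spanned L1 f1 -> spanned L2 f2 -> spanned (L1 ++ L2) (f1 + f2).
Proof.
have [_ [_ [ID _]]] := Iid.
elim: L1 f1 => [|x L1 IH] f1 /= h1 h2; last first.
  by have [c [lc hc]] := h1; exists c; split=> //; rewrite addrAC; apply: IH.
elim: L2 f1 f2 h1 h2 => [|y L2 IH] f1 f2 /= h1 h2; first exact: ID.
by have [c [lc hc]] := h2; exists c; split=> //; rewrite -addrA; apply: IH.
Qed.

Lemma spannedM L f x : O x -> spanned L f -> spanned [seq y * x | y <- L] (f * x).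
Proof.
move=> Ox; elim: L f => [|y L IH] f /=.
  by move=> If; rewrite mulrC; case: Iid => [_ [_ [_ IM]]]; apply: (IM).
by move=> [c [lc hc]]; exists c; split=> //; rewrite mulrA -mulrBl; apply: IH.
Qed.

Lemma spannedP L f : spanned L f -> exists c : nat -> fps K n, (forall t, low (c t)) /\
  I (f - \sum_(t < size L) c t * L`_t).
Proof.
elim: L f => [|x L IH] f /= => [If|[c [lc /IH[c' [lc' h]]]]].
  by exists (fun=> 0); split; [move=> _; apply: low0 | rewrite big_ord0 subr0].
exists (fun t => if t is t'.+1 then c' t' else c); split; first by case.
by rewrite big_ord_recl opprD addrA.
Qed.

Hypothesis dn : (d <= n)%N.
Hypothesis Ireg : forall j : 'I_n, (d <= j)%N ->
  exists g e, [/\ I g, indep (fun i : 'I_n => (j < i)%N) g & g (mpow j e) != 0].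

(** Induction on the number of variables, from d upwards: Weierstrass division by the regular
    element of I leaves finitely many powers of the newest variable, and the multiple of the divisor
    is 0 modulo I. *)
Lemma finite_over_low e : (d <= e <= n)%N -> exists L : seq (fps K n),
  (forall x, x \in L -> O x) /\
  forall f, O f -> indep (fun i : 'I_n => (e <= i)%N) f -> spanned L f.
Proof.
elim: e => [|e IH].
  rewrite leqn0 => /andP[/eqP d0 _]; exists [:: 1].
  split=> [x|f Of hf]; first by rewrite inE => /eqP ->; apply: (adm1 Oadm).
  exists f; split; first by rewrite /low d0.
  by rewrite mulr1 subrr; case: Iid => [_ []].
have [de /andP[_ en]|ed /andP[de _]] := leqP d e; last first.
  have de1 : d = e.+1 by apply/eqP; rewrite eqn_leq de ed.
  exists [:: 1]; split=> [x|f Of hf]; first by rewrite inE => /eqP ->; apply: (adm1 Oadm).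
  exists f; split; first by rewrite /low de1.
  by rewrite mulr1 subrr; case: Iid => [_ []].
have [|L [LO HL]] := IH; first by rewrite de ltnW.
pose j := Ordinal en.
have [g [e0 [Ig hg ge0]]] := Ireg (j := j) de.
have exE : exists E, g (mpow j E) != 0 by exists e0.
(* The least exponent is taken so that the lower pure powers of x_j vanish in g, as the division
   requires. *)
case: (ex_minnP exE) => E gE Emin.
have [IO [I0 [ID IM]]] := Iid.
pose X := fpsX K (munit j).
have OX : O X by apply: (admX Oadm).
(* Generators y * X ^ k with y in L and k < E, nested as in Horner's scheme to match a remainder of
   degree less than E in x_j. *)
pose pieces := fix pieces k := if k is k'.+1 then L ++ [seq y * X | y <- pieces k'] else [::].
exists (pieces E); split.
  elim: (E) => [|k IHk] x //=; rewrite mem_cat => /orP[/LO//|/mapP[y /IHk Oy ->]].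
  exact: (admM Oadm).
have Hp k r : O r -> indep (fun i : 'I_n => (j < i)%N) r ->
    (forall a : mon n, (k <= a j)%N -> r a = 0) -> spanned (pieces k) r.
  elim: k r => [|k IHk] r Or hr rk /=.
    by have -> : r = 0 by apply/funext => a; apply: rk.
  pose r0 := fsel (fun a : mon n => a j == 0%N) r.
  have -> : r = r0 + fshift (munit j) r * X.
    apply/funext => a; rewrite fps_addE mulrC fps_XM munit_le /r0 /fsel /fshift lt0n.
    have [aj|aj] := eqVneq (a j) 0%N; rewrite ?addr0 ?add0r // maddC msubK // munit_le.
    by rewrite lt0n.
  apply: spanned_cat.
    apply: HL; first exact: (adm_sel Oadm).
    move=> a i ei ai; rewrite /r0 /fsel; case: eqP => // aj; apply: (hr a i) => //.
    move: ei; rewrite leq_eqVlt => /orP[/eqP ei|//].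
    by move: ai; have <- : j = i by [apply: val_inj]; rewrite aj.
  apply: spannedM => //; apply: IHk; first exact: (adm_shift Oadm).
    exact: indep_shift.
  by move=> a ka; rewrite /fshift rk // !monE eqxx addn1 ltnS.
move=> f Of hf.
have [|||q [r [Oq Or fE rE rZ]]] :=
    weierstrass_division (W := fun i : 'I_n => (i < j)%N) (j := j) (e := E) Oadm (IO _ Ig) Of _ _ _ gE.
- by rewrite ltnn.
- move=> a i /andP[]; rewrite -leqNgt => ji ij; apply: hg.
  by rewrite ltn_neqAle ji andbT eq_sym.
- move=> k kE; apply/eqP; apply: contraTT kE => gk; rewrite -leqNgt; exact: Emin.
have sr := Hp E r Or (rZ _ hg hf) rE.
rewrite fE -[pieces E]/([::] ++ pieces E); apply: spanned_cat => //=.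
exact: IM.
Qed.

(* Cayley-Hamilton: multiplication by g on the finite O_d-module O / I. *)
Lemma integral_mod g : O g ->
  exists p : {poly fps K n}, [/\ p \is monic, forall k, low p`_k & I p.[g]].
Proof.
move=> Og; have [|L [LO HL]] := @finite_over_low n; first by rewrite dn leqnn.
have HL' f : O f -> spanned L f.
  by move=> Of; apply: HL => // a i; rewrite leqNgt ltn_ord.
have [IO [I0 [ID IM]]] := Iid.
pose N := size L; pose v (t : 'I_N) := L`_t.
have Ov t : O (v t) by apply/LO/mem_nth.
have /choice[c hc] (s : 'I_N) : exists c : nat -> fps K n, (forall t, low (c t)) /\
    I (g * v s - \sum_(t < N) c t * v t).
  by apply/spannedP/HL'/(admM Oadm).
pose A := \matrix_(s < N, t < N) c s t.
exists (char_poly A); split; first exact: char_poly_monic.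
  move=> k; pose P (p : {poly fps K n}) := forall k, low p`_k.
  suff : P (char_poly A) by apply.
  apply: det_closed => [l|l|l|x y Px Py l|x y Px Py l|i j l].
  - by rewrite coef0; apply: low0.
  - by rewrite coef1; case: eqP => _; [apply: low1 | apply: low0].
  - by rewrite coefN coef1; apply: lowN; case: eqP => _; [apply: low1 | apply: low0].
  - by rewrite coefD; apply: lowD.
  - by rewrite coefM; apply: low_sum => i _; apply: lowM.
  - rewrite !mxE coefB coefMn coefX coefC; apply: lowD.
      by case: eqP => _; case: eqP => _; rewrite ?mulr1n ?mulr0n; [apply: low1|apply: low0..].
    by apply: lowN; case: eqP => _; [apply: (hc i).1 | apply: low0].
pose B : 'M[fps K n]_N := g%:M - A.
have -> : (char_poly A).[g] = \det B.
  rewrite -[LHS]/(horner_eval g (char_poly A)) -det_map_mx; congr (\det _).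
  apply/matrixP => i j; by rewrite !mxE rmorphB rmorphMn /= /horner_eval hornerX hornerC.
have OB i j : O (B i j).
  rewrite !mxE; apply: (admB Oadm); last exact: ((hc i).1 j).1.
  by case: eqP => _ //; apply: (adm0 Oadm).
have detO (m : nat) (D : 'M[fps K n]_m) : (forall i j, O (D i j)) -> O (\det D).
  apply: det_closed; [exact: (adm0 Oadm) | exact: (adm1 Oadm) | | exact: (admD Oadm) | exact: (admM Oadm)].
  exact/(admN Oadm)/(adm1 Oadm).
have Oadj i j : O ((\adj B) i j).
  rewrite mxE /cofactor; apply: (admM Oadm).
    by apply: (admXn Oadm); apply/(admN Oadm)/(adm1 Oadm).
  by apply: detO => k l; rewrite !mxE; have := OB (lift j k) (lift i l); rewrite !mxE.
pose V : 'cV[fps K n]_N := \col_t v t.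
have IBV s : I ((B *m V) s 0).
  rewrite mulmxBl mul_scalar_mx !mxE; have [_] := hc s.
  by congr (I (_ - _)); apply: eq_bigr => t _; rewrite !mxE.
have Idet t : I (\det B * v t).
  have -> : \det B * v t = (\adj B *m (B *m V)) t 0.
    by rewrite mulmxA mul_adj_mx mul_scalar_mx !mxE.
  by rewrite mxE; apply: ideal_sum => // s _; apply: (IM).
(* By the adjugate, det B times each generator lies in I; as 1 is a combination of the generators
   modulo I, so does det B. *)
have [e [le he]] := spannedP (HL' 1 (adm1 Oadm)).
rewrite -[\det B]mulr1 -(subrK (\sum_(t < N) e t * v t) 1) mulrDr; apply: (ID).
  by apply: (IM) => //; apply: detO.
rewrite mulr_sumr; apply: ideal_sum => // t _; rewrite mulrCA; apply: (IM) => //.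
exact: (le t).1.
Qed.

Hypothesis Ilow : forall f, I f -> indep (fun i : 'I_n => (d <= i)%N) f -> f = 0.

Let rho l := @fzero K n (fun i => (i < l)%N).

(** The last clause says that P meets O_d inside (x_0, ..., x_(l-1)); it keeps the next variable x_l
    out of P. *)
Definition over_prime l P := [/\ primeO P, forall f, I f -> P f &
  forall f, low f -> P f -> rho l f = 0].

Lemma prime_idealO P : primeO P -> idealO P.
Proof. by move=> [? [? [? [? _]]]]. Qed.

(** The set to avoid consists of the series of O_d that survive x_0 = ... = x_(l-1) = 0; it is
    multiplicative because series form a domain. *)
Lemma exists_over_prime l J : (l <= d)%N -> idealO J -> (forall f, I f -> J f) ->
  (forall f, low f -> J f -> rho l f = 0) ->
  exists P, over_prime l P /\ forall f, J f -> P f.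
Proof.
move=> ld Jid IJ Jl.
have [f [[Of _] _] | | | f Jf [lf] | P [Pp JP PS]] :=
    exists_prime_avoiding (S := fun f => low f /\ rho l f <> 0) Jid.
- exact: Of.
- split; first exact: low1.
  move=> /(congr1 (fun f : fps K n => f (mon0 n))); rewrite fps_0E /rho /fzero /fsel fps_1E eqxx.
  case: forallP => [_|[] i]; first by apply/eqP; rewrite oner_eq0.
  by rewrite mon0E eqxx implybT.
- move=> f g [lf f0] [lg g0]; split; first exact: lowM.
  by rewrite /rho fzeroM => /fps_mul_eq0[].
- by apply; apply: Jl.
exists P; split=> //; split=> // [f /IJ/JP//|f lf Pf].
by apply: contrapT => h; apply: (PS f).
Qed.

(** Going up by hand, adjoining x = x_l to P. If f = p + x g lies in O_d, an integral equation q(g)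
    of degree m, made homogeneous with x and f, gives y in both P and O_d whose term free of the
    factor x is f^m. As y vanishes at x_0 = ... = x_(l-1) = 0, so does f^m once x_l = 0 too. *)
Lemma over_prime_step l P : (l < d)%N -> over_prime l P ->
  exists Q, over_prime l.+1 Q /\ (forall f, P f -> Q f) /\ exists f, Q f /\ ~ P f.
Proof.
move=> ld [Pp IP Pl]; have Pid := prime_idealO Pp.
have ln : (l < n)%N by apply: leq_trans dn.
pose x := fpsX K (munit (Ordinal ln)).
have lx : low x.
  split; first exact: (admX Oadm).
  apply: indep_X => i di; rewrite munitE; case: eqP => // e.
  by move: di; rewrite e /= leqNgt ld.
have Px : ~ P x.
  move/(Pl _ lx)/(congr1 (fun f : fps K n => f (munit (Ordinal ln)))).
  rewrite /rho /fzero /fsel /x /fpsX eqxx fps_0E; case: forallP => [_|[] i].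
    by apply/eqP; rewrite oner_eq0.
  rewrite munitE eqb0; apply/implyP => il.
  by apply: contraTneq il => ->; rewrite /= ltnn.
have rx : rho l.+1 x = 0.
  apply/funext => a; rewrite /rho /fzero /fsel /x /fpsX; case: forallP => // h.
  case: eqP => // ae; have := h (Ordinal ln).
  by rewrite ae munitE eqxx /= ltnS leqnn.
have [|f lf [p [g [Pp' Og fE]]]|Q [Qp PQ]] := exists_over_prime ld (ideal_adjoin Pid lx.1).
- by move=> f /IP Pf; exists f, 0; split; rewrite ?mulr0 ?addr0 //; apply: (adm0 Oadm).
- have [PO [P0 [PD PM]]] := Pid.
  have [q [qm lq Iq]] := integral_mod Og; pose m := (size q).-1.
  have qs : size q = m.+1 by rewrite /m prednK // size_poly_gt0 monic_neq0.
  pose y := \sum_(k < m.+1) q`_k * (x ^+ (m - k) * f ^+ k).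
  have ly : low y by apply: low_sum => k _; apply: lowM => //; apply: lowM; apply: lowXn.
  have Py : P y.
    (* f and x g agree modulo P, so y is congruent to x^m q(g), and q(g) lies in I. *)
    have -> : y = x ^+ m * q.[g] + \sum_(k < m.+1) q`_k * x ^+ (m - k) * (f ^+ k - (x * g) ^+ k).
      rewrite horner_coef qs mulr_sumr -big_split; apply: eq_bigr => -[k /= km] _.
      have -> : x ^+ m = x ^+ (m - k) * x ^+ k by rewrite -exprD subnK.
      by rewrite exprMn; ring.
    apply: (PD); first by apply: (PM); [apply/(admXn Oadm)/lx.1 | apply: IP].
    apply: ideal_sum => // k _; apply: (PM).
      by apply: (admM Oadm); [apply: (lq k).1 | apply/(admXn Oadm)/lx.1].
    rewrite subrXX mulrC; apply: (PM); last by rewrite fE addrK.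
    apply: (adm_sum Oadm) => i _; apply: (admM Oadm); apply: (admXn Oadm); first exact: lf.1.
    by apply: (admM Oadm) => //; apply: lx.1.
  have := Pl y ly Py => /(fzero_sub (Z := fun i => (i < l.+1)%N)) ry.
  have {}ry : rho l.+1 y = 0 by apply: ry => i; apply: ltnW.
  apply: (@fps_exp_eq0 _ _ _ m); rewrite -ry /y big_ord_recr /= subnn expr0 mul1r.
  have -> : q`_m = 1 by move/monicP: qm; rewrite /lead_coef qs.
  rewrite mul1r /rho fzeroD; have -> : fzero (fun i : 'I_n => (i < l.+1)%N)
      (\sum_(k < m) q`_k * (x ^+ (m - k) * f ^+ k)) = 0.
    elim/big_ind: _ => [|u w hu hw|-[k /= km] _]; first exact: fzero0.
      by rewrite fzeroD hu hw addr0.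
    have -> : (m - k = (m - k).-1.+1)%N by rewrite prednK // subn_gt0.
    by rewrite exprS !fzeroM -/(rho l.+1 x) rx !mul0r mulr0.
  by rewrite add0r fzeroXn.
- exists Q; split=> //; split=> [f Pf|].
    by apply: PQ; exists f, 0; split; rewrite ?mulr0 ?addr0 //; apply: (adm0 Oadm).
  exists x; split=> //; apply: PQ; exists 0, 1.
  by split; [case: Pid => [_ []] | apply: (adm1 Oadm) | rewrite mulr1 add0r].
Qed.

Lemma exists_prime_chain : exists p : nat -> fps K n -> Prop,
  chain_len (fun P => primeO P /\ forall f, I f -> P f) p d.
Proof.
suff H k : (k <= d)%N -> exists p : nat -> fps K n -> Prop, over_prime k (p k) /\
    chain_len (fun P => primeO P /\ forall f, I f -> P f) p k.
  by have [p [_ hp]] := H d (leqnn d); exists p.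
elim: k => [|k IH] kd.
  have [//|//|f [Of hf] If|P [hP _]] := @exists_over_prime 0 I _ Iid.
    by rewrite (Ilow If hf) /rho fzero0.
  exists (fun=> P); split=> //; split=> // j _.
  by case: hP.
have [p [pk [pgood pinc]]] := IH (ltnW kd).
have [Q [hQ [pQ newQ]]] := over_prime_step kd pk.
exists (fun j => if (j <= k)%N then p j else Q); rewrite ltnn; split=> //; split=> j.
  by have [jk _|jk _] := leqP j k; [apply: pgood | case: hQ].
rewrite ltnS; case: ltngtP => // [jk _|-> _]; first exact: pinc.
by split.
Qed.

End Normalized.
End Primes.

(** * Modules *)

(** In characteristic zero the integers below [size p] are distinct, and they are too many to be all
    roots. *)
Lemma nonroot (K : fieldType) (p : {poly K}) : [pchar K] =i pred0 -> p != 0 ->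
  exists c, p.[c] != 0.
Proof.
move=> char0 p0; apply: contrapT => h.
have /(max_poly_roots p0) : all (root p) [seq k%:R | k <- iota 0 (size p)].
  apply/allP => c _; apply: contrapT => /negP c0; by apply: h; exists c.
rewrite map_inj_in_uniq ?iota_uniq ?size_map ?size_iota ?ltnn; first by move/(_ isT).
move=> x y _ _ /eqP; rewrite -subr_eq0.
wlog xy : x y / (x <= y)%N.
  move=> H; case/orP: (leq_total x y) => [|yx]; first exact: H.
  by rewrite -opprB oppr_eq0 => /(H _ _ yx).
rewrite -opprB oppr_eq0 -natrB // ((pcharf0P K).1 char0) subn_eq0 => yx.
by apply/eqP; rewrite eqn_leq xy.
Qed.

Section Module.
Variables (K : fieldType) (n : nat) (O : fps K n -> Prop) (M : zmodType).
Hypothesis char0 : [pchar K] =i pred0.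
Hypothesis Oadm : admissible O.
Implicit Types (f g : fps K n) (x y m : M) (gens : seq M).

Section Basics.
Variables (act : fps K n -> M -> M) (der : 'I_n -> M -> M).
Hypothesis D : is_Dmodule O act der.

Lemma actDr f x y : O f -> act f (x + y) = act f x + act f y.
Proof. by case: D => h _; apply: h. Qed.
Lemma actDl f g x : O f -> O g -> act (f + g) x = act f x + act g x.
Proof. by case: D => _ [h _]; apply: h. Qed.
Lemma actM f g x : O f -> O g -> act (f * g) x = act f (act g x).
Proof. by case: D => _ [_ [h _]]; apply: h. Qed.
Lemma act1 x : act 1 x = x.
Proof. by case: D => _ [_ [_ [h _]]]; apply: h. Qed.
Lemma derD i x y : der i (x + y) = der i x + der i y.
Proof. by case: D => _ [_ [_ [_ [h _]]]]; apply: h. Qed.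
Lemma der_act i f x : O f -> der i (act f x) = act (fder i f) x + act f (der i x).
Proof. by case: D => _ [_ [_ [_ [_ [h _]]]]]; apply: h. Qed.
Lemma derC i j x : der i (der j x) = der j (der i x).
Proof. by case: D => _ [_ [_ [_ [_ [_ h]]]]]; apply: h. Qed.

Lemma act0r f : O f -> act f 0 = 0.
Proof. by move=> Of; apply: (additive0 (phi := act f)) => x y; apply: actDr. Qed.
Lemma act0l x : act 0 x = 0.
Proof.
have O0 := adm0 Oadm.
by apply: (addrI (act 0 x)); rewrite -actDl // !addr0.
Qed.
Lemma actNl f x : O f -> act (- f) x = - act f x.
Proof.
move=> Of; apply: (addrI (act f x)).
by rewrite -actDl ?subrr ?act0l //; apply: (admN Oadm).
Qed.
Lemma actC f g x : O f -> O g -> act f (act g x) = act g (act f x).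
Proof. by move=> Of Og; rewrite -!actM // mulrC. Qed.
Lemma der_const i k x : der i (act (fpsC k) x) = act (fpsC k) (der i x).
Proof.
rewrite der_act; last exact: (admC Oadm).
by rewrite (indep_der0 (Z := xpredT)) ?act0l ?add0r //; apply: indepC.
Qed.

Definition annihilator gens f := O f /\ forall m, m \in gens -> act f m = 0.

Lemma annihilator_ideal gens : idealO O (annihilator gens).
Proof.
split=> [f []//|]; split; first by split=> [|m _]; [apply: (adm0 Oadm) | apply: act0l].
split=> [f g [Of fm] [Og gm]|f g Of [Og gm]]; split=> [|m mg].
- exact: (admD Oadm).
- by rewrite actDl // fm // gm // addr0.
- exact: (admM Oadm).
- by rewrite actM // gm // act0r.
Qed.

(** Otherwise each generator is killed by some element outside P; the product of these finitely many
    elements kills all generators and is outside the prime P. *)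
Lemma prime_in_supp gens (P : fps K n -> Prop) : primeO O P ->
  (forall f, annihilator gens f -> P f) -> in_supp O act P.
Proof.
move=> Pp annP; split=> //; apply: contrapT => h.
have [PO [P0 [PD [PM [P1 Ppr]]]]] := Pp.
have H (s : seq M) : exists f, annihilator s f /\ ~ P f.
  elim: s => [|m s [f [[Of fs] Pf]]].
    by exists 1; split=> //; split=> //; apply: (adm1 Oadm).
  have [g [Og [gm Pg]]] : exists g, O g /\ act g m = 0 /\ ~ P g.
    apply: contrapT => hm; apply: h; exists m => g Og gm.
    by apply: contrapT => Pg; apply: hm; exists g.
  exists (f * g); split; last by move=> /(Ppr _ _ Of Og)[].
  split=> [|x]; first exact: (admM Oadm).
  rewrite inE => /orP[/eqP ->|xs]; first by rewrite actM // gm act0r.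
  by rewrite mulrC actM // fs // act0r.
by have [f [/annP Pf]] := H gens.
Qed.

Definition nilpotent_on f x := exists s, act (f ^+ s) x = 0.

Lemma nilpotent_on_le f x s t : O f -> (s <= t)%N -> act (f ^+ s) x = 0 -> act (f ^+ t) x = 0.
Proof.
move=> Of /subnK <- h; rewrite exprD actM ?h; try exact: (admXn Oadm).
by apply/act0r/(admXn Oadm).
Qed.

Lemma nilpotent_onD f x y : O f -> nilpotent_on f x -> nilpotent_on f y -> nilpotent_on f (x + y).
Proof.
move=> Of [s hs] [t ht]; exists (s + t)%N; rewrite actDr; last exact: (admXn Oadm).
by rewrite (nilpotent_on_le Of _ hs) ?leq_addr // (nilpotent_on_le Of _ ht) ?leq_addl ?addr0.
Qed.

(** Leibniz: if f^s x = 0, both other terms vanish in f^(s+1) der x = der (f^(s+1) x) - (s+1) f^s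
    (fder f) x. *)
Lemma nilpotent_on_der f i x : O f -> nilpotent_on f x -> nilpotent_on f (der i x).
Proof.
move=> Of [s hs]; have Ofs k : O (f ^+ k) by apply: (admXn Oadm).
exists s.+1; have h1 : act (f ^+ s.+1) x = 0 by apply: nilpotent_on_le hs.
have Oc : O (s.+1%:R * fder i f).
  by apply: (admM Oadm); [apply: (adm_nat Oadm) | apply: (adm_der Oadm)].
have := der_act i x (Ofs s.+1).
by rewrite h1 (additive0 (derD i)) fderX mulrC actM // hs act0r ?add0r.
Qed.

(** f kills the step from which the filtration grows by derivatives alone, and being killed by a
    power of f passes to derivatives. *)
Lemma good_filtration_torsion F : good_filtration O act der F ->
  exists gens, forall f, annihilator gens f -> forall x, nilpotent_on f x.
Proof.
move=> [Fmod [Fmon [_ [Ffg [Fex [k0 Fgen]]]]]].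
have [gens hg] := Ffg k0; exists gens => f [Of fg].
have base x : F k0 x -> nilpotent_on f x.
  move=> /hg sx; exists 1%N; rewrite expr1.
  by elim: sx => [m /fg //||a b _ ha _ hb|h a Oh _ ha]; rewrite ?act0r // ?actDr ?ha ?hb ?addr0 //
    actC // ha act0r.
have step t x : F (k0 + t)%N x -> nilpotent_on f x.
  elim: t x => [|t IH] x; first by rewrite addn0; apply: base.
  rewrite addnS => /(Fgen _ (leq_addr t k0) x)[y [z [Fy [Fzi ->]]]].
  apply: nilpotent_onD => //; first exact: IH.
  apply: (big_ind (nilpotent_on f)) => [|a b|i _].
  - by exists 0%N; apply: act0r; apply: (adm1 Oadm).
  - exact: nilpotent_onD.
  - by apply: nilpotent_on_der => //; apply: IH.
move=> x; have [k Fk] := Fex x; apply: (step k).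
by elim: (k0) => // l IH; rewrite addSn; apply: Fmon.
Qed.

End Basics.

(** * Shears of a D-module *)

Section Shear.
Variables (act : fps K n -> M -> M) (der : 'I_n -> M -> M).
Hypothesis D : is_Dmodule O act der.
Variables (i e : 'I_n) (s : K).
Hypothesis ie : i != e.

(** The ring stays fixed and f acts through its shear. By the chain rule the Leibniz rule for this
    action then holds for der_e - s der_i in place of der_e. *)
Definition shear_act f := act (fshear i e s f).
Definition shear_der (j : 'I_n) x :=
  if j == e then der e x - act (fpsC s) (der i x) else der j x.

Let Osh f : O f -> O (fshear i e s f). Proof. exact: (adm_shear Oadm). Qed.
Let Oc k : O (fpsC k). Proof. exact: (admC Oadm). Qed.

Lemma shear_Dmodule : is_Dmodule O shear_act shear_der.
Proof.
rewrite /shear_act; split; first by move=> f x y Of; apply: (actDr D); apply: Osh.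
split=> [f g x Of Og|].
  by rewrite psadd_fps fshearD (actDl D) //; apply: Osh.
split=> [f g x Of Og|].
  by rewrite psmul_fps fshearM // (actM D) //; apply: Osh.
split=> [x|]; first by rewrite ps1_fps fshear1 // (act1 D).
have cD x y : act (fpsC s) (x + y) = act (fpsC s) x + act (fpsC s) y by apply: (actDr D).
split=> [j x y|].
  rewrite /shear_der; case: eqP => _; rewrite !(derD D) //.
  by rewrite cD opprD addrACA.
split=> [j f x Of|j k x].
  have Os := Osh Of; rewrite psder_fps /shear_der; case: eqP => [->|/eqP je].
    rewrite !(der_act D) // fshear_der_e // fshear_der_other // cD.
    have O1 : O (fder e f) by apply: (adm_der Oadm).
    have O2 : O (fder i f) by apply: (adm_der Oadm).
    rewrite (actDl D); [|exact: Osh|apply: (admM Oadm) => //; exact: Osh].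
    rewrite (actM D) //; last exact: Osh.
    rewrite (additiveB (phi := act (fshear i e s f))); last by move=> u v; apply: (actDr D).
    rewrite (actC D _ (Oc s) Os).
    by rewrite opprD addrA [X in X - _ - _]addrAC addrK -addrA.
  by rewrite (der_act D) // fshear_der_other.
rewrite /shear_der; do 2 case: eqP => // _.
- by rewrite (additiveB (derD D k)) (der_const D) (derC D e k) (derC D i k).
- by rewrite (additiveB (derD D j)) (der_const D) (derC D j e) (derC D j i).
- by rewrite (derC D).
Qed.

(** The shear is an automorphism of O, so a chain of primes in the new support is carried to one of
    the same length in the old support. *)
Lemma shear_lt_dim t : lt_n_sub_dim O act t -> lt_n_sub_dim O shear_act t.
Proof.
move=> h p k [pgood pinc].
have shK f : fshear i e (- s) (fshear i e s f) = f.
  by rewrite -{2}(opprK s) fshearK.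
have Osh' f : O f -> O (fshear i e (- s) f) by apply: (adm_shear Oadm).
apply: (h (fun j f => O f /\ p j (fshear i e (- s) f)) k); split=> j jk; last first.
  have [psub [x [px npx]]] := pinc j jk.
  split=> [f [Of pf]|]; first by split=> //; apply: psub.
  have [[pO _] _] := pgood j.+1 jk.
  exists (fshear i e s x); rewrite !shK; split; first by split=> //; apply/Osh/pO.
  by case.
have [[pO [p0 [pD [pM [p1 pp]]]]] [m hm]] := pgood j jk.
split; last first.
  exists m => f Of fm; split=> //; apply: hm; first exact: Osh'.
  by rewrite /shear_act fshearK.
split; first by move=> f [].
split; first by split; [apply: (adm0 Oadm) | rewrite ps0_fps fshear_0].
split=> [f g [Of pf] [Og pg]|].
  by split; [apply: (admD Oadm) | rewrite psadd_fps fshearD; apply: pD].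
split=> [f g Of [Og pg]|].
  split; [exact: (admM Oadm) | rewrite psmul_fps fshearM //; apply: pM => //].
  exact: Osh'.
split; first by move=> []; rewrite ps1_fps fshear1.
move=> f g Of Og [_]; rewrite psmul_fps fshearM // => /pp[]; try exact: Osh'.
- by left.
- by right.
Qed.

End Shear.

(** * Putting the annihilator in normal position *)

Section Normalization.
Variables (act0 : fps K n -> M -> M) (der0 : 'I_n -> M -> M) (t : nat) (gens : seq M).
Hypothesis D0 : is_Dmodule O act0 der0.

(* The D-module structures obtained from (act0, der0) by linear changes of coordinates. *)
Record coordinates (act : fps K n -> M -> M) (der : 'I_n -> M -> M) : Prop := Coordinates {
  coordD : is_Dmodule O act der;
  coord_dim : lt_n_sub_dim O act t;
  coord_tor : forall f, annihilator act gens f -> forall x, nilpotent_on act f x;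
  coord_row : exists C : 'M[K]_n, forall j x,
    der j x = \sum_k act0 (fpsC (C j k)) (der0 k x);
  coord_const : forall k x, act (fpsC k) x = act0 (fpsC k) x }.

Definition regular_at act (j : 'I_n) := exists g e,
  [/\ annihilator act gens g, indep (fun i : 'I_n => (j < i)%N) g & g (mpow j e) != 0].

Lemma annihilator_shear act i e s f : i != e -> annihilator act gens f ->
  annihilator (shear_act act i e s) gens (fshear i e (- s) f).
Proof.
move=> ie [Of fg]; split=> [|m mg]; first exact: (adm_shear Oadm).
by rewrite /shear_act fshearK // fg.
Qed.

Lemma coordinates_shear act der i e s : i != e -> coordinates act der ->
  coordinates (shear_act act i e s) (shear_der act der i e s).
Proof.
move=> ie [D dim tor [C hC] cst]; split.
- exact: shear_Dmodule.
- exact: shear_lt_dim.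
- move=> f [Of fg] x; have [k hk] : nilpotent_on act (fshear i e s f) x.
    by apply: tor; split=> //; apply: (adm_shear Oadm).
  by exists k; rewrite /shear_act fshearXn.
- exists (\matrix_(a, b) if a == e then C e b - s * C i b else C a b) => j x.
  rewrite /shear_der; case: eqP => je; last first.
    by rewrite hC; apply: eq_bigr => k _; rewrite mxE; case: eqP.
  have Oc k : O (fpsC k) by apply: (admC Oadm).
  rewrite !hC cst (additive_sum (phi := act0 (fpsC s))) => [|u v]; last exact: (actDr D0).
  rewrite -sumrB; apply: eq_bigr => k _; rewrite mxE je eqxx fpsCD fpsCN fpsCM.
  by rewrite (actDl D0) ?(actNl D0) ?(actM D0) //; rewrite -fpsCM -?fpsCN.
- by move=> k x; rewrite /shear_act fshear_const.
Qed.

(** A pure power of x_j contains no x_e, so its coefficient is unchanged, and the shear brings in no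
    variable beyond x_j. *)
Lemma regular_shear act (i e j : 'I_n) s : i != e -> (i <= j)%N -> (e < j)%N ->
  regular_at act j -> regular_at (shear_act act i e s) j.
Proof.
move=> ie ij ej [g [E [ag ig gE]]]; exists (fshear i e (- s) g), E; split.
- exact: annihilator_shear.
- by apply: indep_shear => //; rewrite -leqNgt // ltnW.
- rewrite fshear_coef0 // monE; case: eqP => // eej.
  by move: ej; rewrite eej ltnn.
Qed.

(** Shears x_i := x_i + c x_j clear the exponents of the variables before x_j one at a time, always
    keeping some exponent with nonzero coefficient; at the end this exponent is a pure power of
    x_j. *)
Lemma regularize act der (j : 'I_n) f : coordinates act der ->
  (forall k : 'I_n, (j < k)%N -> regular_at act k) ->
  annihilator act gens f -> indep (fun i : 'I_n => (j < i)%N) f -> f <> 0 ->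
  exists act' der', coordinates act' der' /\ forall k : 'I_n, (j <= k)%N -> regular_at act' k.
Proof.
move=> cact reg annf indf f0.
suff H (l : nat) : (l <= j)%N -> exists act' der', [/\ coordinates act' der',
    forall k : 'I_n, (j < k)%N -> regular_at act' k &
    exists g a, [/\ annihilator act' gens g, indep (fun i : 'I_n => (j < i)%N) g, g a != 0 &
      forall k : 'I_n, (k < l)%N -> a k = 0%N]].
  have [act' [der' [cact' reg' [g [a [ag ig ga a0]]]]]] := H j (leqnn j).
  exists act', der'; split=> // k; rewrite leq_eqVlt => /orP[/eqP jk|]; last exact: reg'.
  have <- : j = k by apply: val_inj.
  exists g, (a j); split=> //.
  suff -> : mpow j (a j) = a by [].
  apply: monP => i; rewrite monE; case: eqVneq => [->//|ij].
  have [ji|ij'] := ltnP j i.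
    by apply/esym/eqP; rewrite -leqn0 leqNgt; apply: contra ga => ai; rewrite (ig a i).
  by rewrite a0 // ltn_neqAle ij' andbT.
elim: l => [_|l IH lj].
  exists act, der; split=> //.
  have [a fa] : exists a, f a != 0.
    apply: contrapT => h; apply: f0; apply/funext => a; apply: contrapT => fa.
    by apply: h; exists a; apply/eqP.
  by exists f, a.
have [act' [der' [cact' reg' [g [a [ag ig ga a0]]]]]] := IH (ltnW lj).
have ln : (l < n)%N by apply: leq_trans (ltnW (ltn_ord j)); apply: leq_trans lj _.
pose i := Ordinal ln.
have ij : i != j by rewrite -val_eqE /= neq_ltn lj.
have ji : j != i by rewrite eq_sym.
(* b moves the exponent of x_i over to x_j. The coefficient of b in the shear of g by c is p.[c],
   and p is nonzero because its coefficient at [a i] is g a. *)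
pose b : mon n := [ffun k => if k == i then 0%N else if k == j then (a j + a i)%N else a k].
pose p : {poly K} := \poly_(k < (b j).+1) g (madd (msub b (mpow j k)) (mpow i k)).
have bj : b j = (a j + a i)%N by rewrite ffunE (negPf ji) eqxx.
have p0 : p != 0.
  apply: contra ga => /eqP /(congr1 (fun q : {poly K} => q`_(a i))).
  rewrite coef0 coef_poly bj ltnS leq_addl => <-; apply/eqP; congr g.
  apply: monP => k; rewrite !monE ffunE; case: (eqVneq k i) => [->|ki].
    by rewrite eq_sym (negPf ji); mlia.
  by case: eqVneq => [->|_]; mlia.
have [c pc] := nonroot char0 p0.
(* Annihilating elements move by the opposite parameter, so -c on the action shears g by c. *)
exists (shear_act act' i j (- c)), (shear_der act' der' i j (- c)); split.
- exact: coordinates_shear.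
- by move=> k jk; apply: regular_shear => //; [apply: ltnW; apply: leq_trans jk; rewrite ltnS ltnW | apply: reg'].
- exists (fshear i j c g), b; split.
  + by rewrite -{2}[c]opprK; apply: annihilator_shear.
  + by apply: indep_shear => //; rewrite -leqNgt // ltnW.
  + apply: contra pc => /eqP e; apply/eqP; rewrite -[RHS]e horner_poly; apply: eq_bigr => k _.
    rewrite /fdiv mulrC; congr (_ * _).
    have -> : msub b (mpow j k) i = 0%N by rewrite !monE (negPf ij) ffunE eqxx.
    by rewrite add0n binn mul1r.
  + move=> k; rewrite ltnS leq_eqVlt ffunE => /orP[/eqP ki|kl].
      by have -> : k = i by [apply: val_inj]; rewrite eqxx.
    case: eqP => // _; case: eqP => [kj|_]; last exact: a0.
    by move: kl lj; rewrite kj => jl lj; have := ltn_trans jl lj; rewrite ltnn.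
Qed.

(** Descent on e: either the annihilator has no nonzero element in the first e variables and d = e,
    or such an element is made regular in the last of them. At e = 0 a nonzero element would be a
    constant, hence a unit killing the nonzero generator m. *)
Lemma normalization act der e : (exists2 m, m \in gens & m != 0) -> (e <= n)%N ->
  coordinates act der -> (forall j : 'I_n, (e <= j)%N -> regular_at act j) ->
  exists act' der' d, [/\ (d <= n)%N, coordinates act' der',
    forall j : 'I_n, (d <= j)%N -> regular_at act' j &
    forall f, annihilator act' gens f -> indep (fun i : 'I_n => (d <= i)%N) f -> f = 0].
Proof.
move=> [m mg m0]; elim: e act der => [|e IH] act der en cact reg.
  exists act, der, 0%N; split=> // f [Of fg] indf.
  have D := coordD cact.
  have [f0|f0] := eqVneq (f (mon0 n)) 0.
    apply/funext => a; have [->//|a0] := eqVneq a (mon0 n).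
    apply: contrapT => /eqP fa; case/eqP: a0; apply: monP => i; rewrite mon0E.
    by apply/eqP; rewrite -leqn0 leqNgt; apply: contra fa => ai; rewrite (indf a i).
  have [g [Og fg1 _]] := adm_inv Oadm Of f0; case/eqP: m0.
  by rewrite -(act1 D m) -fg1 mulrC (actM D) // fg // (act0r D).
have [h|] := pselect (forall f, annihilator act gens f ->
    indep (fun i : 'I_n => (e.+1 <= i)%N) f -> f = 0).
  by exists act, der, e.+1.
move=> /existsNP[f /not_implyP[annf /not_implyP[indf f0]]].
have [act' [der' [cact' reg']]] := regularize (j := Ordinal en) cact reg annf indf f0.
exact: IH (ltnW en) cact' reg'.
Qed.

(** * Regularity of the derivations with index at least d *)

Section Regularity.
Variables (act : fps K n -> M -> M) (der : 'I_n -> M -> M) (d : nat).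
Hypothesis cact : coordinates act der.
Hypothesis dn : (d <= n)%N.
Hypothesis reg : forall j : 'I_n, (d <= j)%N -> regular_at act j.
Hypothesis nolow : forall f, annihilator act gens f ->
  indep (fun i : 'I_n => (d <= i)%N) f -> f = 0.

Let D := coordD cact.

Lemma normalized_dim : (t + d < n)%N.
Proof.
have [p [pgood pinc]] := exists_prime_chain Oadm (annihilator_ideal D gens) dn reg nolow.
apply: (coord_dim cact (p := p)); split=> // j jd.
have [pp annp] := pgood j jd; exact: (prime_in_supp D pp annp).
Qed.

(** L lists the derivations not yet divided out. Once the image of der_k has joined A, only
    multiplication by series with zero k-th derivative is sure to preserve A. *)
Definition d_stable (L : seq 'I_n) (A : M -> Prop) := A 0 /\
  (forall x y, A x -> A y -> A (x + y)) /\ (forall j x, A x -> A (der j x)) /\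
  (forall f x, O f -> (forall k : 'I_n, (d <= k)%N -> k \notin L -> fder k f = 0) -> A x -> A (act f x)).

(** G is F^s, where F is the integral equation of x_l over O_d evaluated at x_l. The leading term
    keeps F nonzero when the other variables are set to 0, hence F^s too since series form a domain;
    e is the exponent of a surviving term. *)
Lemma axis_element (l : 'I_n) x : (d <= l)%N -> exists G e, [/\ O G,
  indep (fun i : 'I_n => (d <= i)%N && (i != l)) G, G (mpow l e) != 0 & act G x = 0].
Proof.
move=> dl; pose X := fpsX K (munit l).
have OX : O X by apply: (admX Oadm).
have [q [qm lq Iq]] := integral_mod Oadm (annihilator_ideal D gens) dn reg OX.
have indF : indep (fun i : 'I_n => (d <= i)%N && (i != l)) q.[X].
  rewrite horner_coef; elim/big_ind: _ => [|u v hu hv|k _]; [exact: indep0|exact: indepD|].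
  apply: indepM; first by apply: indep_sub (lq k).2 => i /andP[].
  by apply/indepXn/indep_X => i /andP[_ il]; rewrite munitE (negPf il).
have FE : q.[X] (mpow l (size q).-1) = 1.
  have qs : size q = (size q).-1.+1 by rewrite prednK // size_poly_gt0 monic_neq0.
  have Xn k : X ^+ k = fpsX K (mpow l k).
    by rewrite /X -[fpsX K _]mul1r -(fpsC1 K n) -/(sX l 1) (sX_exp l 1) expr1n fpsC1 mul1r.
  rewrite horner_coef qs big_ord_recr /= fps_addE fps_sumE big1 => [|[k /= kq] _].
    have -> : q`_(size q).-1 = 1 by apply/eqP.
    by rewrite mul1r add0r Xn /fpsX eqxx.
  rewrite mulrC Xn fps_XM mle_pow monE eqxx (ltnW kq).
  apply: ((lq k).2 _ l) => //.
  by rewrite !monE eqxx subn_gt0.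
have [s Fs] := coord_tor cact Iq x.
pose Z (i : 'I_n) := i != l.
have : fzero Z (q.[X] ^+ s) <> 0.
  rewrite fzeroXn => /fps_exp_eq0 /(congr1 (fun f : fps K n => f (mpow l (size q).-1))).
  rewrite /fzero /fsel FE fps_0E; case: forallP => [_|[] i]; first by apply/eqP; rewrite oner_eq0.
  by apply/implyP => /negPf il; rewrite monE il.
move=> H; have [a Ga] : exists a, fzero Z (q.[X] ^+ s) a != 0.
  apply: contrapT => h; apply: H; apply/funext => a; apply: contrapT => Ga.
  by apply: h; exists a; apply/eqP.
exists (q.[X] ^+ s), (a l); split=> //.
- by apply: (admXn Oadm); case: Iq.
- exact: indepXn.
move: Ga; rewrite /fzero /fsel; case: forallP => [h|_]; last by rewrite eqxx.
suff -> : mpow l (a l) = a by [].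
apply: monP => i; rewrite monE; case: eqVneq => [->//|il].
by have /implyP/(_ il)/eqP -> := h i.
Qed.

(* Differentiating G x = 0 repeatedly, where G lies in O_d[[x_l]] and is x_l-regular, gives
   u x = 0 modulo A for a unit u. *)
Lemma der_injective_mod L l A x : d_stable L A -> l \in L -> (d <= l)%N ->
  A (der l x) -> A x.
Proof.
move=> [A0 [AD [Ad Aact]]] lL dl Al.
have [G [e [OG indG Ge Gx]]] := axis_element x dl.
have OGk k : O (iter k (fder l) G).
  by elim: k => //= k IH; apply: (adm_der Oadm).
have indGk k : indep (fun i : 'I_n => (d <= i)%N && (i != l)) (iter k (fder l) G).
  by elim: k => //= k IH; apply: indep_der.
have Aact' f y : O f -> indep (fun i : 'I_n => (d <= i)%N && (i != l)) f -> A y -> A (act f y).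
  move=> Of indf; apply: Aact => // k dk kL; apply: (indep_der0 _ indf).
  by rewrite dk /=; apply: contraNneq kL => ->.
have AN y : A y -> A (- y).
  move=> Ay; have -> : - y = act (fpsC (-1)) y.
    by rewrite fpsCN fpsC1 (actNl D) ?(act1 D) //; apply: (adm1 Oadm).
  by apply: Aact' => //; [apply: (admC Oadm) | apply: indepC].
have H k : A (act (iter k (fder l) G) x).
  elim: k => [|k IH] /=; first by rewrite Gx.
  have -> : act (fder l (iter k (fder l) G)) x =
      der l (act (iter k (fder l) G) x) - act (iter k (fder l) G) (der l x).
    by rewrite (der_act D) // addrK.
  by apply: AD; [apply: Ad | apply/AN/Aact'].
(* This constant term is e! times the coefficient of x_l^e in G. *)
have u0 : iter e (fder l) G (mon0 n) != 0.
  rewrite iter_fderE maddC madd0 mulf_neq0 // prodf_seq_neq0; apply/allP => j _ /=.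
  by rewrite mon0E add0n ((pcharf0P K).1 char0).
have [v [Ov uv indv]] := adm_inv Oadm (OGk e) u0.
rewrite -(act1 D x) -uv mulrC (actM D) //; apply: Aact' => //.
exact: indv.
Qed.

(** The complex remains that of [der0]: the rows of C write the normalized derivations as
    directional derivatives with constant coefficients, and the n - d of index at least d form the
    regular sequence. *)
Lemma dim_vanishing : dR_vanish der0 t.
Proof.
have [C hC] := coord_row cact.
have Oc k : O (fpsC k) by apply: (admC Oadm).
pose c (j : 'I_n) (k : 'I_n) := act0 (fpsC (C j k)).
pose scal (phi : M -> M) := exists k, phi = act0 (fpsC k).
have cS phi : scal phi -> scalar_map der0 phi.
  move=> [k ->]; split=> [x y|j x]; first by rewrite (actDr D0).
  by rewrite (der_const D0).
have cC phi psi : scal phi -> scal psi -> forall x, phi (psi x) = psi (phi x).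
  by move=> [k ->] [l ->] x; apply: (actC D0).
have cE j x : dirder der0 (c j) x = der j x by rewrite hC.
pose L := filter (fun j : 'I_n => (d <= j)%N) (enum 'I_n).
have regL : regular_mod der0 scal (fun x => x = 0) (map c L).
  have : uniq L by rewrite filter_uniq ?enum_uniq.
  have : forall l, l \in L -> (d <= l)%N by move=> l; rewrite mem_filter => /andP[].
  have : d_stable L (fun x => x = 0).
    split=> //; split=> [x y -> ->|]; first by rewrite addr0.
    by split=> [j x ->|f x Of _ ->]; [apply: additive0 (derD D j) | apply: (act0r D)].
  elim: L (fun x : M => x = 0) => [|l L IH] //= A stA dL /andP[lL uL].
  split=> [j|x|]; first by exists (C l j).
    by rewrite cE; apply: (der_injective_mod stA); rewrite ?dL ?mem_head.
  apply: IH => // [|k kL]; last by apply: dL; rewrite inE kL orbT.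
  have [A0 [AD [Ad Aact]]] := stA.
  have dl : (d <= l)%N by apply: dL; rewrite mem_head.
  split; first by exists 0, 0; rewrite cE (additive0 (derD D l)) addr0.
  split=> [x y [a [u [Aa ->]]] [b [v [Ab ->]]]|].
    exists (a + b), (u + v); split; first exact: AD.
    by rewrite !cE (derD D) addrACA.
  split=> [j x [a [u [Aa ->]]]|f x Of fk [a [u [Aa ->]]]].
    exists (der j a), (der j u); split; first exact: Ad.
    by rewrite !cE (derD D) (derC D).
  (* l has left the list, so f has zero l-th derivative and commutes with der_l. *)
  exists (act f a), (act f u); split.
    apply: Aact => // k dk; rewrite inE negb_or => /andP[_ kL]; exact: fk.
  by rewrite !cE (actDr D) // (der_act D) // fk // (act0l D) add0r.
have sizeL : (t < size (map c L))%N.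
  rewrite size_map; have := normalized_dim; rewrite addnC -ltn_subRL => tn; apply: leq_trans tn _.
  rewrite size_filter -(count_map val (leq d)) val_enum_ord -{2}(subnKC dn) iotaD count_cat.
  have /eqP -> : count (leq d) (iota (0 + d) (n - d)) == size (iota (0 + d) (n - d)).
    by rewrite -all_count; apply/allP => k; rewrite mem_iota add0n => /andP[].
  by rewrite size_iota leq_addl.
move=> w wi dw.
have stable0 : stable der0 scal (fun x => x = 0).
  split=> //; split=> [x y -> ->|]; first by rewrite addr0.
  split=> [x ->|]; first by rewrite oppr0.
  split=> [j x ->|phi x /cS[phiD _] ->]; first exact: (additive0 (derD D0 j)).
  exact: (additive0 phiD).
have [v [vi hv]] := koszul_vanishing (derD D0) (derC D0) cS cC stable0 regL sizeL wi dw.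
by exists v; split=> // J; apply/esym/eqP; rewrite -subr_eq0 hv.
Qed.
End Regularity.
End Normalization.
End Module.

Lemma DR_vanishing (K : fieldType) (n : nat) (O : PS K n -> Prop) :
  [pchar K] =i pred0 -> admissible (O : fps K n -> Prop) -> DR_vanishing_thm O.
Proof.
move=> char0 Oadm M act der D [F [Fgood _]] i dim.
have [gens tor] := good_filtration_torsion Oadm D Fgood.
(* If all generators vanish, 1 annihilates them, so every element is killed by a power of 1 and M =
   0. *)
have [nz|zero] := pselect (exists2 m, m \in gens & m != 0); last first.
  have M0 (x : M) : x = 0.
    have [|s] := tor 1 _ x; last by rewrite expr1n (act1 D).
    split=> [|m mg]; first exact: adm1.
    by rewrite (act1 D); apply: contrapT => /eqP m0; apply: zero; exists m.
  by move=> w _ _; exists (fun=> 0); split=> // J; rewrite [LHS]M0 [RHS]M0.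
have cact : coordinates O act der i gens act der.
  split=> //; exists 1%:M => j x.
  rewrite (bigD1 j) //= big1 => [|k kj].
    by rewrite mxE eqxx fpsC1 (act1 D) addr0.
  by rewrite mxE eq_sym (negPf kj) fpsC0 (act0l Oadm D).
have [j|act' [der' [d [dn cact' reg nolow]]]] := normalization char0 Oadm D nz (leqnn n) cact.
  by rewrite leqNgt ltn_ord.
exact: (dim_vanishing char0 Oadm D cact' dn reg nolow).
Qed.

Theorem theorem4 :
  (forall (K : fieldType), [pchar K]%R =i pred0 ->
     forall n : nat, DR_vanishing_thm (fun _ : PS K n => True)) /\
  (forall (R : realType) (n : nat), DR_vanishing_thm (@convergent R n)).
Proof.
split=> [K char0 n|R n]; apply: DR_vanishing.
- exact: char0.
- exact: admissible_formal.
- exact: pchar_num.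
- exact: admissible_complex.
Qed.
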